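(* There exists a finite-time algorithm that, given a Garside group $G$, makes a (finite) list of primitive periodic elements of $G$ such that for each primitive periodic element $g$ of $G$ there is exactly one element $h$ in the list such that $g$ is conjugate to $h$ or to $h^{-1}$.
   Context: Garside groups. In a monoid $M$, an atom is an element $a\neq 1$ such that $a=bc$ implies $b=1$ or $c=1$; $\Vert a\Vert$ is the supremum of the lengths of expressions of $a$ as products of atoms. $M$ is atomic if it is generated by its atoms and $\Vert a\Vert<\infty$ for all $a\in M$. Put $a\le_L b$ if $ac=b$ for some $c\in M$, and $a\le_R b$ if $ca=b$ for some $c\in M$. A Garside monoid is an atomic, left and right cancellative monoid $M$ such that $(M,\le_L)$ and $(M,\le_R)$ are lattices and $M$ contains a Garside element $\Delta$, i.e. an element such that for each $a\in M$, $a\le_L\Delta$ iff $a\le_R\Delta$, and the set $[1,\Delta]=\{a\in M: 1\le_L a\le_L\Delta\}$ of simple elements is finite and generates $M$. A Garside group $G$ with Garside element $\Delta$ is the group of fractions of a Garside monoid $M$ with Garside element $\Delta$. The input group is given by its Garside structure, i.e. by finite data such as the finite set $[1,\Delta]$ together with its partial multiplication ($a\cdot b=c$ for $a,b,c\in[1,\Delta]$); elements of $G$ are represented by words in the simple elements and their inverses. An element $g\in G$ is periodic if $g^k=\Delta^\ell$ for some integers $k\neq0$ and $\ell$. A nonidentity element $g\in G$ is primitive if $g=h^k$ with $h\in G$ and $k\in\mathbb Z$ implies $k=\pm1$. *)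

(* Defs.v *)
From mathcomp Require Import all_boot all_algebra.
From Corelib Require Import Relation_Definitions.

Set Implicit Arguments.
Unset Strict Implicit.
Unset Printing Implicit Defensive.

Local Open Scope group_scope.

(** An algorithm is a program of the WHILE language over binary trees (N. D. Jones,
"Computability and Complexity from a Programming Perspective"), a Turing
complete language, written here in point-free form: a program transforms a
single tree.  A Rocq function would not do, since classical axioms make
uncomputable functions definable. *)

Inductive tree := Leaf | Node of tree & tree.

Definition left_tree t := if t is Node l _ then l else Leaf.
Definition right_tree t := if t is Node _ r then r else Leaf.

Inductive prog :=
| PId
| PLeaf
| PNode of prog & prog
| PLeft
| PRight
| PSeq of prog & prog
| PIf of prog & prog & prog
| PWhile of prog & prog.

(** [runs p t u]: the program [p], started on [t], halts with result [u].
In tests, [Leaf] stands for false and every other tree for true. *)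
Inductive runs : prog -> tree -> tree -> Prop :=
| RId t : runs PId t t
| RLeaf t : runs PLeaf t Leaf
| RNode p q t u v : runs p t u -> runs q t v -> runs (PNode p q) t (Node u v)
| RLeft t : runs PLeft t (left_tree t)
| RRight t : runs PRight t (right_tree t)
| RSeq p q t u v : runs p t u -> runs q u v -> runs (PSeq p q) t v
| RIfT c p q t u1 u2 v :
    runs c t (Node u1 u2) -> runs p t v -> runs (PIf c p q) t v
| RIfF c p q t v : runs c t Leaf -> runs q t v -> runs (PIf c p q) t v
| RWhileT c p t u1 u2 v w :
    runs c t (Node u1 u2) -> runs p t v -> runs (PWhile c p) v w ->
    runs (PWhile c p) t w
| RWhileF c p t : runs c t Leaf -> runs (PWhile c p) t t.

Lemma runs_det p t u v : runs p t u -> runs p t v -> u = v.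
Proof.
move=> tu; elim: tu v => {p t u}; intros;
  match goal with r : runs _ _ ?v |- _ = ?v => inversion r; subst end;
  repeat match goal with
  | IH : forall v, runs ?p ?t v -> ?u = v, r : runs ?p ?t ?v |- _ =>
      have ? := IH _ r; clear r; subst
  end; congruence.
Qed.

Definition encode_bool (b : bool) := if b then Node Leaf Leaf else Leaf.

Definition encode_pair A B (eA : A -> tree) (eB : B -> tree) (x : A * B) :=
  Node (eA x.1) (eB x.2).

Definition encode_option A (eA : A -> tree) (o : option A) :=
  if o is Some a then Node Leaf (eA a) else Leaf.

Definition encode_seq A (eA : A -> tree) (s : seq A) :=
  foldr (fun a t => Node (eA a) t) Leaf s.

Definition encode_nat (m : nat) := iter m (Node Leaf) Leaf.

Definition encode_ord n (i : 'I_n) := encode_nat i.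

Lemma encode_bool_inj : injective encode_bool.
Proof. by case=> [] []. Qed.

Lemma encode_pair_inj A B (eA : A -> tree) (eB : B -> tree) :
  injective eA -> injective eB -> injective (encode_pair eA eB).
Proof. by move=> iA iB [a b] [a' b'] [/iA /= -> /iB /= ->]. Qed.

Lemma encode_option_inj A (eA : A -> tree) :
  injective eA -> injective (encode_option eA).
Proof. by move=> iA [a|] [a'|] //= [/iA ->]. Qed.

Lemma encode_seq_inj A (eA : A -> tree) :
  injective eA -> injective (encode_seq eA).
Proof. by move=> iA; elim=> [|a s IH] [|a' s'] //= [/iA -> /IH ->]. Qed.

Lemma encode_ord_inj n : injective (@encode_ord n).
Proof.
move=> i j; rewrite /encode_ord => e; apply: val_inj => /=.
by elim: (nat_of_ord i) (nat_of_ord j) e => [|k IH] [|l] //= [/IH ->].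
Qed.

Section GarsideMonoid.
Variable M : monoidType.
Implicit Types (a b c Delta : M) (S : M -> Prop).

Definition atom a := a <> 1 /\ forall b c, a = b * c -> b = 1 \/ c = 1.

Definition generates S :=
  forall a, exists2 w : seq M, {in w, forall x, S x} & \prod_(x <- w) x = a.

(** The length [||a||], a supremum of natural numbers, is finite. *)
Definition finite_length a :=
  exists N, forall w : seq M,
    {in w, forall x, atom x} -> \prod_(x <- w) x = a -> size w <= N.

Definition atomic := generates atom /\ forall a, finite_length a.

Definition leL a b := exists c, a * c = b.
Definition leR a b := exists c, c * a = b.

Definition is_lub (le : relation M) a b j :=
  [/\ le a j, le b j & forall x, le a x -> le b x -> le j x].
Definition is_glb (le : relation M) a b m :=
  [/\ le m a, le m b & forall x, le x a -> le x b -> le x m].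
Definition is_lattice (le : relation M) :=
  order M le /\
  forall a b, (exists j, is_lub le a b j) /\ (exists m, is_glb le a b m).

Definition simple Delta a := leL 1 a /\ leL a Delta.

Definition garside_element Delta :=
  [/\ forall a, leL a Delta <-> leR a Delta,
      exists l : seq M, forall a, simple Delta a -> a \in l
    & generates (simple Delta)].

Record garside_monoid Delta : Prop := GarsideMonoid {
  garside_atomic : atomic;
  garside_cancelL : forall a b c, a * b = a * c -> b = c;
  garside_cancelR : forall a b c, b * a = c * a -> b = c;
  garside_latticeL : is_lattice leL;
  garside_latticeR : is_lattice leR;
  garside_Delta : garside_element Delta
}.

End GarsideMonoid.

Definition group_of_fractions (M : monoidType) (G : groupType) (iota : M -> G) :=
  [/\ monoid_morphism iota, injective iota
    & forall g : G, exists a b, g = iota a / iota b].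

(** [s] numbers the simple elements as [0, ..., n - 1], and [mul] is their
partial multiplication in terms of these numbers. *)
Definition garside_structure (M : monoidType) (Delta : M) n
    (s : 'I_n -> M) (mul : 'I_n -> 'I_n -> option 'I_n) :=
  [/\ injective s,
      forall a, simple Delta a <-> exists i, s i = a
    & forall i j k, mul i j = Some k <-> s i * s j = s k].

Definition encode_structure n (mul : 'I_n -> 'I_n -> option 'I_n) : tree :=
  encode_seq (encode_seq (encode_option (@encode_ord n)))
    [seq [seq mul i j | j <- enum 'I_n] | i <- enum 'I_n].

(** The letter [(i, false)] denotes the simple element number [i], and
[(i, true)] denotes its inverse. *)
Definition word n := seq ('I_n * bool).

Definition eval_word n (M : monoidType) (G : groupType) (iota : M -> G)
    (s : 'I_n -> M) (w : word n) : G :=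
  \prod_(x <- w) (if x.2 then (iota (s x.1))^-1 else iota (s x.1)).

Definition encode_words n : seq (word n) -> tree :=
  encode_seq (encode_seq (encode_pair (@encode_ord n) encode_bool)).

Lemma encode_words_inj n : injective (@encode_words n).
Proof.
apply: encode_seq_inj; apply: encode_seq_inj.
exact: encode_pair_inj (@encode_ord_inj n) encode_bool_inj.
Qed.

Section GroupElements.
Variable G : groupType.
Implicit Types g h x : G.

Definition expgz g (k : int) : G :=
  match k with Posz m => g ^+ m | Negz m => g ^- m.+1 end.

Definition periodic (Delta g : G) :=
  exists k l : int, k <> 0%R /\ expgz g k = expgz Delta l.

Definition primitive g :=
  g <> 1 /\ forall h (k : int), g = expgz h k -> k = 1%R \/ k = (-1)%R.

Definition conjugate g h := exists x, g ^ x = h.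

End GroupElements.

(* Main.v *)
(** Let e = n! where n is the number of simple elements.  Conjugation by Delta
permutes these, so D = Delta^e is central.  If g is primitive and periodic,
then g and D generate a torsion-free abelian group of rank one; being
primitive, g generates it, so g or g^-1 is a q-th root of D for some q > 0.
If g^q = D and c is the least upper bound of 1, g, ..., g^(q-1), then c <= g c,
so the conjugate x = c^-1 g c lies in the monoid and divides x^q = D.  Hence x is
a product of e simple elements, and q is bounded by the number of words of
length e, because the powers of x up to x^q are distinct divisors of D.

Two roots x, y of D in the monoid are conjugate if and only if words for them,
padded with 1 to the same length > e, are related by the moves "rotate the word"
and "move a factor between the first two letters".  Indeed, words with equal
product and equal length have the same greedy normal form; and if x c = c y with
c <> 1, then some simple s <> 1 divides both c and x, and replacing x = s x' by
x' s is a rotation that shortens c.  So conjugacy of roots of D, being a root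
of D, and being a proper power are all decided by reachability in finite graphs
of words.  All loops have computable bounds, so that the programs need no
recursion beyond folding over lists. *)

(* Before Defs, because fingroup also defines [conjugate]. *)
From mathcomp Require Import fingroup perm cyclic.
Require Import Defs.
From mathcomp Require Import all_boot all_algebra.

Set Implicit Arguments.
Unset Strict Implicit.
Unset Printing Implicit Defensive.

(** * Computable functions between encoded types *)

(** Canonical instances let [computable] infer the encoding from the type. *)
Structure codeType := CodeType { code_sort :> Type; encode : code_sort -> tree }.

Canonical bool_code := CodeType encode_bool.
Canonical nat_code := CodeType encode_nat.
Canonical prod_code (A B : codeType) :=
  CodeType (encode_pair (@encode A) (@encode B)).
Canonical seq_code (A : codeType) := CodeType (encode_seq (@encode A)).

Definition computable (A B : codeType) (f : A -> B) :=
  exists p, forall a, runs p (encode a) (encode (f a)).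

Section Computable.
Variables (G A B C : codeType).

Lemma computable_id : computable (fun x : G => x).
Proof. by exists PId => x; constructor. Qed.

Lemma computable_comp (f : G -> A) (h : A -> B) :
  computable h -> computable f -> computable (fun x => h (f x)).
Proof. by move=> [p hp] [q hq]; exists (PSeq q p) => x; econstructor. Qed.

Lemma computable_pair (f : G -> A) (h : G -> B) :
  computable f -> computable h -> computable (fun x => (f x, h x)).
Proof. by move=> [p hp] [q hq]; exists (PNode p q) => x; constructor. Qed.

Lemma computable_fst (f : G -> A * B) :
  computable f -> computable (fun x => (f x).1).
Proof.
move=> [p hp]; exists (PSeq p PLeft) => x.
by econstructor; [exact: hp | exact: (RLeft (encode (f x)))].
Qed.

Lemma computable_snd (f : G -> A * B) :
  computable f -> computable (fun x => (f x).2).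
Proof.
move=> [p hp]; exists (PSeq p PRight) => x.
by econstructor; [exact: hp | exact: (RRight (encode (f x)))].
Qed.

Lemma computable_if (b : G -> bool) (f h : G -> A) :
  computable b -> computable f -> computable h ->
  computable (fun x => if b x then f x else h x).
Proof.
move=> [pb hb] [p hp] [q hq]; exists (PIf pb p q) => x.
by move: (hb x); case: (b x) => hbx; [apply: RIfT hbx _ | apply: RIfF hbx _].
Qed.

Lemma computable_leaf (a : A) : encode a = Leaf -> computable (fun _ : G => a).
Proof. by move=> ea; exists PLeaf => x; rewrite ea; constructor. Qed.

End Computable.

Section Lists.
Variables (G A B : codeType).

Lemma computable_nil : computable (fun _ : G => [::] : seq A).
Proof. exact: computable_leaf. Qed.

Lemma computable_cons (f : G -> A) (s : G -> seq A) :
  computable f -> computable s -> computable (fun x => f x :: s x).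
Proof. by move=> [p hp] [q hq]; exists (PNode p q) => x; constructor. Qed.

Lemma computable_behead (s : G -> seq A) :
  computable s -> computable (fun x => behead (s x)).
Proof.
move=> [p hp]; exists (PSeq p PRight) => x; econstructor; first exact: hp.
have -> : encode (behead (s x)) = right_tree (encode (s x)) by case: (s x).
by constructor.
Qed.

(* The default must have code [Leaf], because [PLeft] maps [Leaf] to [Leaf]. *)
Lemma computable_head (a : A) (s : G -> seq A) : encode a = Leaf ->
  computable s -> computable (fun x => head a (s x)).
Proof.
move=> ea [p hp]; exists (PSeq p PLeft) => x; econstructor; first exact: hp.
have -> : encode (head a (s x)) = left_tree (encode (s x)) by case: (s x).
by constructor.
Qed.

Lemma computable_foldl (f : G -> B -> A -> B) (z : G -> B) (s : G -> seq A) :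
  computable (fun y : G * (B * A) => f y.1 y.2.1 y.2.2) ->
  computable z -> computable s ->
  computable (fun x => foldl (f x) (z x) (s x)).
Proof.
(* The loop state codes the triple (x, (remaining list, accumulator)). *)
move=> [p hp] [pz hz] [ps hs].
pose body := PNode PLeft (PNode (PSeq PRight (PSeq PLeft PRight))
  (PSeq (PNode PLeft (PNode (PSeq PRight PRight)
                            (PSeq PRight (PSeq PLeft PLeft)))) p)).
pose state x b l := Node (encode (x : G))
  (Node (encode (l : seq A)) (encode (b : B))).
have test t : runs (PSeq PRight PLeft) t (left_tree (right_tree t)).
  exact: RSeq (RRight _) (RLeft _).
have loop x l b : runs (PWhile (PSeq PRight PLeft) body)
    (state x b l) (state x (foldl (f x) b l) [::]).
  elim: l b => [|a l IH] b; first exact: RWhileF (test (state x b [::])).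
  apply: (@RWhileT _ _ _ (encode a) (encode l)) (IH (f x b a)).
    exact: test (state x b (a :: l)).
  apply: RNode (RLeft _) (RNode (RSeq (RRight _) (RSeq (RLeft _) (RRight _))) _).
  apply: RSeq (hp (x, (b, a))).
  apply: RNode (RLeft _) (RNode (RSeq (RRight _) (RRight _)) _).
  exact: RSeq (RRight _) (RSeq (RLeft _) (RLeft _)).
exists (PSeq (PNode PId (PNode ps pz))
  (PSeq (PWhile (PSeq PRight PLeft) body) (PSeq PRight PRight))) => x.
apply: (@RSeq _ _ _ (state x (z x) (s x))).
  by apply: RNode; [constructor | apply: RNode].
exact: RSeq (loop _ _ _) (RSeq (RRight _) (RRight _)).
Qed.

End Lists.

Section Arithmetic.
Variable G : codeType.
Implicit Types m n k : G -> nat.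

Lemma computable_0 : computable (fun _ : G => 0).
Proof. exact: computable_leaf. Qed.

Lemma computable_false : computable (fun _ : G => false).
Proof. exact: computable_leaf. Qed.

Lemma computable_succ n : computable n -> computable (fun x => (n x).+1).
Proof.
by move=> [p hp]; exists (PNode PLeaf p) => x; exact: RNode (RLeaf _) (hp x).
Qed.

Lemma computable_true : computable (fun _ : G => true).
Proof. by exists (PNode PLeaf PLeaf) => x; exact: RNode (RLeaf _) (RLeaf _). Qed.

Lemma computable_pred n : computable n -> computable (fun x => (n x).-1).
Proof.
move=> [p hp]; exists (PSeq p PRight) => x; econstructor; first exact: hp.
have -> : encode (n x).-1 = right_tree (encode (n x)) by case: (n x).
by constructor.
Qed.

Lemma computable_eq0 n : computable n -> computable (fun x => n x == 0).
Proof.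
move=> [p hp]; exists (PIf p PLeaf (PNode PLeaf PLeaf)) => x.
move: (hp x); case: (n x) => [|k] r; last exact: RIfT r (RLeaf _).
exact: RIfF r (RNode (RLeaf _) (RLeaf _)).
Qed.

(* A natural number has the same code as the list of so many zeros. *)
Lemma computable_iter (A : codeType) (f : G -> A -> A) (z : G -> A) n :
  computable (fun y : G * A => f y.1 y.2) -> computable z -> computable n ->
  computable (fun x => iter (n x) (f x) (z x)).
Proof.
move=> cf cz [p hp].
have cn : computable (fun x => nseq (n x) 0).
  exists p => x; have -> : encode (nseq (n x) 0) = encode (n x).
    by rewrite /=; elim: (n x) => //= k ->.
  exact: hp.
have [|q hq] := @computable_foldl _ _ _ (fun x a (_ : nat) => f x a) z _ _ cz cn.
  apply: (computable_comp (f := fun y => (y.1, y.2.1)) cf).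
  apply: computable_pair; first exact: computable_fst (computable_id _).
  exact: computable_fst (computable_snd (computable_id _)).
exists q => x; move: (hq x); congr (runs _ _ (encode _)).
by elim: (n x) (z x) => //= k IH a; rewrite IH -iterSr.
Qed.

End Arithmetic.
Lemma computable_eq (G A : codeType) (f h : G -> A) :
  f =1 h -> computable f -> computable h.
Proof. by move=> fh [p hp]; exists p => x; rewrite -fh. Qed.

Lemma computable_comp2 (G A B C : codeType) (f : A -> B -> C) u v :
  computable (fun y : A * B => f y.1 y.2) -> computable u -> computable v ->
  computable (fun x : G => f (u x) (v x)).
Proof. by move=> cf cu cv; apply: (computable_comp cf (computable_pair cu cv)). Qed.

Lemma computable_comp3 (G A B C D : codeType) (f : A -> B -> C -> D) u v w :
  computable (fun y : A * (B * C) => f y.1 y.2.1 y.2.2) ->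
  computable u -> computable v -> computable w ->
  computable (fun x : G => f (u x) (v x) (w x)).
Proof.
move=> cf cu cv cw.
by apply: (computable_comp cf (computable_pair cu (computable_pair cv cw))).
Qed.

(* The goal is matched syntactically, since higher-order unification may diverge. *)
Ltac computable_step := cbv beta; first
  [ match goal with H : computable _ |- _ => exact: H end
  | lazymatch goal with
    | |- computable (fun x => x) => exact: computable_id
    | |- computable fst => exact: (computable_fst (computable_id _))
    | |- computable snd => exact: (computable_snd (computable_id _))
    | |- computable (fun x => [::]) => exact: computable_nil
    | |- computable (fun x => 0) => exact: computable_0
    | |- computable (fun x => true) => exact: computable_true
    | |- computable (fun x => false) => exact: computable_false
    | |- computable (fun x => (@?f x, @?h x)) =>
        apply: (@computable_pair _ _ _ f h)
    | |- computable (fun x => (@?f x).1) => apply: (@computable_fst _ _ _ f)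
    | |- computable (fun x => (@?f x).2) => apply: (@computable_snd _ _ _ f)
    | |- computable (fun x => @?f x :: @?s x) =>
        apply: (@computable_cons _ _ f s)
    | |- computable (fun x => behead (@?s x)) =>
        apply: (@computable_behead _ _ s)
    | |- computable (fun x => if _ then _ else _) => apply: computable_if
    | |- computable (fun x => (@?n x).+1) => apply: (@computable_succ _ n)
    | |- computable (fun x => (@?n x).-1) => apply: (@computable_pred _ n)
    | |- computable (fun x => @?n x == 0) => apply: (@computable_eq0 _ n)
    | |- computable (fun x => foldl (@?f x) (@?z x) (@?s x)) =>
        apply: (@computable_foldl _ _ _ f z s)
    | |- computable (fun x => iter (@?n x) (@?f x) (@?z x)) =>
        apply: (@computable_iter _ _ f z n)
    end
  | match goal with
    | H : computable (fun y => ?h y.1 y.2.1 y.2.2)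
      |- computable (fun x => ?h (@?u x) (@?v x) (@?w x)) =>
        apply: (@computable_comp3 _ _ _ _ _ h u v w H)
    | H : computable (fun y => ?h y.1 y.2)
      |- computable (fun x => ?h (@?u x) (@?v x)) =>
        apply: (@computable_comp2 _ _ _ _ h u v H)
    | H : computable ?h |- computable (fun x => ?h (@?u x)) =>
        apply: (@computable_comp _ _ _ u h H)
    end ].

Ltac computability := do !computable_step.

(** * Derived operations on booleans, lists and numbers *)

Section Booleans.
Variable G : codeType.
Implicit Types b c : G -> bool.

Lemma computable_negb b : computable b -> computable (fun x => ~~ b x).
Proof.
move=> cb; apply: (@computable_eq _ _ (fun x => if b x then false else true)).
  by move=> x; case: (b x).
by computability.
Qed.

Lemma computable_andb b c :
  computable b -> computable c -> computable (fun x => b x && c x).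
Proof.
move=> cb cc; apply: (@computable_eq _ _ (fun x => if b x then c x else false)).
  by move=> x; case: (b x).
by computability.
Qed.

Lemma computable_orb b c :
  computable b -> computable c -> computable (fun x => b x || c x).
Proof.
move=> cb cc; apply: (@computable_eq _ _ (fun x => if b x then true else c x)).
  by move=> x; case: (b x).
by computability.
Qed.

End Booleans.

Lemma computable_rev (G A : codeType) (s : G -> seq A) :
  computable s -> computable (fun x => rev (s x)).
Proof.
move=> cs; apply: (@computable_eq _ _ (fun x =>
  foldl (fun t a => a :: t) [::] (s x))); last by computability.
move=> x; rewrite -[s x in LHS]revK foldl_rev.
by elim: (rev _) => //= a t ->.
Qed.

(** A right fold is a left fold over the reversed list. Most list operations below are instances of
    it. *)
Lemma computable_foldr (G A B : codeType) (f : G -> A -> B -> B) (z : G -> B)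
    (s : G -> seq A) :
  computable (fun y : G * (A * B) => f y.1 y.2.1 y.2.2) ->
  computable z -> computable s ->
  computable (fun x => foldr (f x) (z x) (s x)).
Proof.
move=> cf cz /computable_rev cs.
apply: (@computable_eq _ _ (fun x =>
  foldl (fun b a => f x a b) (z x) (rev (s x)))); last by computability.
by move=> x; rewrite foldl_rev.
Qed.

Ltac computable_foldr_step := cbv beta; first
  [ computable_step
  | lazymatch goal with
    | |- computable (fun x => foldr (@?f x) (@?z x) (@?s x)) =>
        apply: (@computable_foldr _ _ _ f z s)
    | |- computable (fun x => ~~ @?b x) => apply: (@computable_negb _ b)
    | |- computable (fun x => @?b x && @?c x) =>
        apply: (@computable_andb _ b c)
    | |- computable (fun x => @?b x || @?c x) => apply: (@computable_orb _ b c)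
    end ].

Section Lists.
Variables G A B : codeType.
Implicit Types (s t : G -> seq A) (n m : G -> nat).

Lemma computable_cat s t :
  computable s -> computable t -> computable (fun x => s x ++ t x).
Proof.
move=> cs ct; apply: (@computable_eq _ _ (fun x => foldr cons (t x) (s x))).
  by move=> x; elim: (s x) => //= a u ->.
by do !computable_foldr_step.
Qed.

Lemma computable_map (f : G -> A -> B) s :
  computable (fun y : G * A => f y.1 y.2) -> computable s ->
  computable (fun x => map (f x) (s x)).
Proof.
move=> cf cs; apply: (@computable_eq _ _ (fun x =>
  foldr (fun a u => f x a :: u) [::] (s x))).
  by move=> x; elim: (s x) => //= a u ->.
by do !computable_foldr_step.
Qed.

Lemma computable_filter (b : G -> A -> bool) s :
  computable (fun y : G * A => b y.1 y.2) -> computable s ->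
  computable (fun x => filter (b x) (s x)).
Proof.
move=> cb cs; apply: (@computable_eq _ _ (fun x =>
  foldr (fun a u => if b x a then a :: u else u) [::] (s x))).
  by move=> x; elim: (s x) => //= a u ->.
by do !computable_foldr_step.
Qed.

Lemma computable_has (b : G -> A -> bool) s :
  computable (fun y : G * A => b y.1 y.2) -> computable s ->
  computable (fun x => has (b x) (s x)).
Proof.
move=> cb cs; apply: (@computable_eq _ _ (fun x =>
  foldr (fun a u => b x a || u) false (s x))).
  by move=> x; elim: (s x) => //= a u ->.
by do !computable_foldr_step.
Qed.

Lemma computable_all (b : G -> A -> bool) s :
  computable (fun y : G * A => b y.1 y.2) -> computable s ->
  computable (fun x => all (b x) (s x)).
Proof.
move=> cb cs; apply: (@computable_eq _ _ (fun x =>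
  foldr (fun a u => b x a && u) true (s x))).
  by move=> x; elim: (s x) => //= a u ->.
by do !computable_foldr_step.
Qed.

Lemma computable_size s : computable s -> computable (fun x => size (s x)).
Proof.
move=> cs; apply: (@computable_eq _ _ (fun x =>
  foldr (fun _ k => k.+1) 0 (s x))).
  by move=> x; elim: (s x) => //= a u ->.
by do !computable_foldr_step.
Qed.

Lemma computable_nth (a : A) s n : encode a = Leaf ->
  computable s -> computable n -> computable (fun x => nth a (s x) (n x)).
Proof.
move=> ea cs cn; apply: (@computable_eq _ _ (fun x =>
  head a (iter (n x) behead (s x)))).
  move=> x; elim: (n x) (s x) => [|k IH] u; first exact: nth0.
  by rewrite iterSr IH nth_behead.
by apply: computable_head => //; do !computable_foldr_step.
Qed.

Lemma computable_nseq (f : G -> A) n :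
  computable f -> computable n -> computable (fun x => nseq (n x) (f x)).
Proof.
move=> cf cn; apply: (@computable_eq _ _ (fun x =>
  iter (n x) (cons (f x)) [::])) => //.
by do !computable_foldr_step.
Qed.

Lemma computable_add m n :
  computable m -> computable n -> computable (fun x => m x + n x).
Proof.
move=> cm cn; apply: (@computable_eq _ _ (fun x => iter (m x) succn (n x))).
  by move=> x; rewrite iter_succn addnC.
by do !computable_foldr_step.
Qed.

Lemma computable_sub m n :
  computable m -> computable n -> computable (fun x => m x - n x).
Proof.
move=> cm cn; apply: (@computable_eq _ _ (fun x => iter (n x) predn (m x))).
  by move=> x; rewrite iter_predn.
by do !computable_foldr_step.
Qed.

End Lists.

Section MoreLists.
Variables G A : codeType.
Implicit Types m n : G -> nat.

Lemma computable_flatten (s : G -> seq (seq A)) :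
  computable s -> computable (fun x => flatten (s x)).
Proof.
move=> cs; apply: (@computable_foldr _ _ _ (fun _ => cat)) cs.
  apply: computable_cat; by do !computable_foldr_step.
by do !computable_foldr_step.
Qed.

Lemma computable_mul m n :
  computable m -> computable n -> computable (fun x => m x * n x).
Proof.
move=> cm cn; apply: (@computable_eq _ _ (fun x => iter (m x) (addn (n x)) 0)).
  by move=> x; rewrite iter_addn_0 mulnC.
apply: (@computable_iter _ _ (fun x => addn (n x))) cm.
  by apply: (@computable_add _ (fun y => n y.1)); do !computable_foldr_step.
by do !computable_foldr_step.
Qed.

Lemma computable_iota m n :
  computable m -> computable n -> computable (fun x => iota (m x) (n x)).
Proof.
(* Each round shifts the whole list by one and puts [m x] back in front. *)
move=> cm cn; apply: (@computable_eq _ _ (fun x =>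
  iter (n x) (fun s => m x :: map succn s) [::])).
  move=> x; elim: (n x) => //= k ->.
  by rewrite -[(m x).+1]add1n iotaDl.
apply: (@computable_iter _ _ (fun x s => m x :: map succn s)) cn.
  apply: computable_cons; first by do !computable_foldr_step.
  by apply: (@computable_map _ _ _ (fun _ => succn)); do !computable_foldr_step.
by do !computable_foldr_step.
Qed.

Lemma computable_eqn m n :
  computable m -> computable n -> computable (fun x => m x == n x).
Proof.
move=> cm cn; apply: (@computable_eq _ _ (fun x =>
  (m x - n x == 0) && (n x - m x == 0))).
  by move=> x; rewrite !subn_eq0 -eqn_leq.
by apply: computable_andb; apply: computable_eq0; apply: computable_sub.
Qed.

End MoreLists.

Ltac computable_list_step := cbv beta; first
  [ computable_foldr_step
  | lazymatch goal with
    | |- computable (fun x => @?s x ++ @?t x) =>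
        apply: (@computable_cat _ _ s t)
    | |- computable (fun x => map (@?f x) (@?s x)) =>
        apply: (@computable_map _ _ _ f s)
    | |- computable (fun x => filter (@?f x) (@?s x)) =>
        apply: (@computable_filter _ _ f s)
    | |- computable (fun x => has (@?f x) (@?s x)) =>
        apply: (@computable_has _ _ f s)
    | |- computable (fun x => all (@?f x) (@?s x)) =>
        apply: (@computable_all _ _ f s)
    | |- computable (fun x => size (@?s x)) => apply: (@computable_size _ _ s)
    | |- computable (fun x => head ?a (@?s x)) =>
        apply: (@computable_head _ _ a s); first by []
    | |- computable (fun x => nth ?a (@?s x) (@?n x)) =>
        apply: (@computable_nth _ _ a s n); first by []
    | |- computable (fun x => nseq (@?n x) (@?f x)) =>
        apply: (@computable_nseq _ _ f n)
    | |- computable (fun x => flatten (@?s x)) =>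
        apply: (@computable_flatten _ _ s)
    | |- computable (fun x => @?m x + @?n x) => apply: (@computable_add _ m n)
    | |- computable (fun x => @?m x * @?n x) => apply: (@computable_mul _ m n)
    | |- computable (fun x => iota (@?m x) (@?n x)) =>
        apply: (@computable_iota _ m n)
    | |- computable (fun x => @?m x == @?n x) => apply: (@computable_eqn _ m n)
    end ].

Ltac computable_lists := do !computable_list_step.

Lemma computable_eq_seq (G : codeType) (s t : G -> seq nat) :
  computable s -> computable t -> computable (fun x => s x == t x).
Proof.
move=> cs ct; apply: (@computable_eq _ _ (fun x => (size (s x) == size (t x)) &&
  all (fun i => nth 0 (s x) i == nth 0 (t x) i) (iota 0 (size (s x))))).
  move=> x; apply/andP/eqP => [[/eqP e /allP h] | ->].
    by apply: (@eq_from_nth _ 0) => // i lti; apply/eqP/h; rewrite mem_iota.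
  by split=> //; apply/allP.
by computable_lists.
Qed.

Lemma computable_mem (G : codeType) (w : G -> seq nat) (s : G -> seq (seq nat)) :
  computable w -> computable s -> computable (fun x => w x \in s x).
Proof.
move=> cw cs; apply: (@computable_eq _ _ (fun x =>
  has (fun v => v == w x) (s x))).
  by move=> x; elim: (s x) => //= v u ->; rewrite inE eq_sym.
apply: (@computable_has _ (seq_code nat_code)
  (fun x (v : seq nat) => v == w x)) cs.
by apply: computable_eq_seq; computable_lists.
Qed.
(** * The algorithm *)

Section Dedupe.
Variables (T : eqType) (r : rel T).

Definition dedupe s :=
  foldr (fun u us => if has (r u) us then us else u :: us) [::] s.

Lemma dedupe_sub s : {subset dedupe s <= s}.
Proof.
elim: s => //= u s IH v; case: ifP => _; last rewrite inE => /orP [/eqP ->|].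
- by move=> /IH; rewrite inE orbC => ->.
- exact: mem_head.
- by move=> /IH; rewrite inE orbC => ->.
Qed.

Lemma dedupe_complete s u : u \in s ->
  exists2 v, v \in dedupe s & u = v \/ r u v.
Proof.
elim: s => //= w s IH; rewrite inE => /orP [/eqP ->|/IH [v vs uv]].
  case: ifP => [/hasP [v vs wv] | _]; first by exists v => //; right.
  by exists w; [exact: mem_head | left].
by case: ifP => _; exists v => //; rewrite inE vs orbT.
Qed.

(** An element is tested only against later survivors. Which of [r u v] and [r v u] was refuted
    depends on the order, so both are assumed. *)
Lemma dedupe_unrelated s u v : u \in dedupe s -> v \in dedupe s ->
  r u v -> r v u -> u = v.
Proof.
elim: s => //= w s IH; case: ifP => [_|/hasPn nr]; first exact: IH.
rewrite !inE => /orP [/eqP ->|us] /orP [/eqP ->|vs] //; last exact: IH.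
  by move=> wv; rewrite (negPf (nr v vs)) in wv.
by move=> _ wu; rewrite (negPf (nr u us)) in wu.
Qed.

Lemma dedupe_uniq s : {in s, forall u, r u u} -> uniq (dedupe s).
Proof.
elim: s => //= w s IH rs.
have us : uniq (dedupe s) by apply: IH => u us; apply: rs; rewrite inE us orbT.
case: ifP => //= /hasPn nr; rewrite us andbT; apply/negP => /nr.
by rewrite rs ?mem_head.
Qed.

End Dedupe.

(* The letters of a word number the simple elements, and the entry [k.+1] at
[(i, j)] of a table says that the product of [i] and [j] is [k]; the entry [0]
says that it is not simple. *)
Definition table := seq (seq nat).

Definition entry (t : table) i j := nth 0 (nth [::] t i) j.

Definition letters (t : table) := iota 0 (size t).

(** The table does not mark the identity; by cancellation 1 is the only idempotent. *)
Definition one_letter t := head 0 [seq i <- letters t | entry t i i == i.+1].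

(** [Delta] is recognised as the greatest simple element for left divisibility. *)
Definition delta_letter t := head 0 [seq d <- letters t |
  all (fun i => has (fun j => entry t i j == d.+1) (letters t)) (letters t)].

(** The first alternative moves the factor [r] from the second letter to the first, the other one
    moves it back. The relation on pairs is thus symmetric and preserves the product. *)
Definition transferable t a b c d := has (fun r =>
  (entry t a r == c.+1) && (entry t r d == b.+1) ||
  (entry t c r == a.+1) && (entry t r b == d.+1)) (letters t).

Definition transfers t u := flatten [seq
  [seq c :: d :: behead (behead u) | d <-
     [seq d <- letters t | transferable t (head 0 u) (head 0 (behead u)) c d]]
  | c <- letters t].

(** On words of fewer than two letters the default 0 is read and the length may change, whence the
    assumption [1 < size u] in the soundness lemmas. *)
Definition moves t u := (behead u ++ [:: head 0 u]) :: transfers t u.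

Definition words t m :=
  iter m (fun ws => flatten [seq [seq a :: w | w <- ws] | a <- letters t])
    [:: [::]].

Definition closure t k u :=
  iter k (fun ws => ws ++ flatten [seq moves t w | w <- ws]) [:: u].

Definition pad t u m := u ++ nseq m (one_letter t).

(* Padding makes room for splitting a simple element off a word. *)
Definition connected t u v := pad t v (size u) \in
  closure t (size (words t (size u + size v))) (pad t u (size v)).

(** A factorial, spelt out as a fold to make it computable by the lemmas above. *)
Definition central_exponent (t : table) :=
  foldr (fun i p => i * p) 1 (iota 1 (size t)).

Definition power k (u : seq nat) := flatten (nseq k u).

Definition central_words t := words t (central_exponent t).

(** As D is central, being conjugate to D means being equal to it. The range of [q] suffices by
    [root_exponent_bound]. *)
Definition is_root t u := has (fun q =>
  connected t (power q u) (nseq (central_exponent t) (delta_letter t)))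
  (iota 1 (size (central_words t))).

(** A root of a root of D is again a root of D, so up to conjugacy it is the value of a word of
    length e. *)
Definition is_power t u := has (fun v =>
  has (fun k => connected t (power k v) u) (iota 2 (size (central_words t))))
  (central_words t).

Definition representatives t := dedupe (connected t)
  [seq u <- central_words t | is_root t u && ~~ is_power t u].

Ltac computable_mem_step := first
  [ computable_list_step
  | lazymatch goal with
    | |- computable (fun x => @?w x \in @?s x) =>
        apply: (@computable_mem _ w s)
    end ].

Lemma computable_representatives :
  computable (representatives : seq (seq nat) -> seq (seq nat)).
Proof.
apply: (@computable_eq (seq_code (seq_code nat_code)) _
  (fun t => representatives t)) => //.
rewrite /representatives /dedupe /is_root /is_power /central_words /connected /closure.
rewrite /pad /power /central_exponent /words /moves /transfers /transferable.
rewrite /delta_letter /one_letter /letters /entry /table.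
by do !computable_mem_step.
Qed.
(** * Garside monoids *)

Local Open Scope group_scope.

Section Garside.
Variables (M : monoidType) (Delta : M).
Hypothesis gM : garside_monoid Delta.
Implicit Types a b c d x y z : M.

Let cancelL := garside_cancelL gM.
Let cancelR := garside_cancelR gM.
Let DeltaLR : forall a, leL a Delta <-> leR a Delta.
Proof. by have [] := garside_Delta gM. Qed.

Lemma leL_anti a b : leL a b -> leL b a -> a = b.
Proof. by have [[_ _ anti] _] := garside_latticeL gM; apply: anti. Qed.

Lemma leL_trans b a c : leL a b -> leL b c -> leL a c.
Proof. by have [[_ tr _] _] := garside_latticeL gM; apply: tr. Qed.

Lemma leL_refl a : leL a a.
Proof. by exists 1; rewrite mulg1. Qed.

Lemma le1x a : leL 1 a.
Proof. by exists a; rewrite mul1g. Qed.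

Lemma leL_mulr a b : leL a (a * b).
Proof. by exists b. Qed.

Lemma leL_mul2l a b c : leL (a * b) (a * c) <-> leL b c.
Proof.
split=> -[d]; last by move <-; exists d; rewrite mulgA.
by rewrite -mulgA => /cancelL; exists d.
Qed.

Lemma glb_ex a b : exists m, is_glb (@leL M) a b m.
Proof. by have [_ /(_ a b) []] := garside_latticeL gM. Qed.

Lemma lub_ex a b : exists m, is_lub (@leL M) a b m.
Proof. by have [_ /(_ a b) []] := garside_latticeL gM. Qed.

Lemma glb_uniq a b m m' :
  is_glb (@leL M) a b m -> is_glb (@leL M) a b m' -> m = m'.
Proof. by move=> [? ? h] [? ? h']; apply: leL_anti; auto. Qed.

Lemma simpleE a : simple Delta a <-> leL a Delta.
Proof. by split=> [[] | aD] //; split=> //; exact: le1x. Qed.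

Lemma simple_prod a : exists2 w : seq M,
  (forall x, x \in w -> leL x Delta) & \prod_(x <- w) x = a.
Proof.
have [_ _ /(_ a) [w ws wa]] := garside_Delta gM.
by exists w => // x /ws /simpleE.
Qed.

Lemma conical a b : a * b = 1 -> a = 1.
Proof. by move=> ab; apply: leL_anti (le1x a); exists b. Qed.

Lemma torsion_free x n : 0 < n -> x ^+ n = 1 -> x = 1.
Proof. by case: n => // n _; rewrite expgS; exact: conical. Qed.

(** Left and right divisors of [Delta] coincide, and a right factor of a right divisor is a right
    divisor. *)
Lemma leL_factor_simple r b : leL (r * b) Delta -> leL b Delta.
Proof.
move=> /DeltaLR [c rb]; apply/DeltaLR; exists (c * r).
by rewrite -mulgA.
Qed.

(** Take the double complement: if [a * b = Delta = b * c], then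
    [a * Delta = a * b * c = Delta * c]. *)
Lemma Delta_slide_simple a : leL a Delta ->
  exists2 y, leL y Delta & a * Delta = Delta * y.
Proof.
move=> [b ab]; have /DeltaLR [c bc] : leR b Delta by exists a.
exists c; first by apply/DeltaLR; exists b.
by rewrite -{1}bc mulgA ab.
Qed.

Lemma Delta_slide x : exists y, x * Delta = Delta * y.
Proof.
have [w] := simple_prod x; elim: w x => [|a w IH] x ws <-.
  by exists 1; rewrite big_nil mul1g mulg1.
have [||y hy] := IH (\prod_(b <- w) b) => //.
  by move=> b bw; apply: ws; rewrite inE bw orbT.
have [c _ hc] := Delta_slide_simple (ws a (mem_head _ _)).
by exists (c * y); rewrite big_cons -mulgA hy mulgA hc mulgA.
Qed.

Lemma Delta_slide_back x : exists y, y * Delta = Delta * x.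
Proof.
have [w] := simple_prod x; elim: w x => [|a w IH] x ws <-.
  by exists 1; rewrite big_nil mul1g mulg1.
have [||y hy] := IH (\prod_(b <- w) b) => //.
  by move=> b bw; apply: ws; rewrite inE bw orbT.
(* Here complements are taken on the left: [a' * a = Delta = a'' * a'] gives
   [a'' * Delta = Delta * a]. *)
have /DeltaLR [a' aa'] := ws a (mem_head _ _).
have /DeltaLR [a'' aa''] : leL a' Delta by exists a.
exists (a'' * y); rewrite big_cons -mulgA hy mulgA -{1}aa'.
by rewrite !mulgA aa''.
Qed.

Lemma leL_mulr_Delta x y : leL (x * Delta) (y * Delta) <-> leL x y.
Proof.
split=> -[z].
  have [z' hz'] := Delta_slide_back z.
  by rewrite -mulgA -hz' mulgA => /cancelR; exists z'.
by move <-; have [z' hz'] := Delta_slide z; exists z'; rewrite -!mulgA hz'.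
Qed.

(* If [z] is the meet of [x] and [Delta ^+ m], then right multiplication by
[Delta] makes [z * Delta] the meet of [x * Delta] and [Delta ^+ m.+1]. *)
Lemma leL_Delta_exp_factor x m : leL x (Delta ^+ m.+1) ->
  exists z a, [/\ x = z * a, leL z (Delta ^+ m) & leL a Delta].
Proof.
move=> xD; have [z [zx zD zmax]] := glb_ex x (Delta ^+ m).
have [a xE] := zx; exists z, a; split=> //.
apply: (leL_mul2l z _ _).1; rewrite xE.
have [p [px pD pmax]] := glb_ex (x * Delta) (Delta ^+ m.+1).
(* [Delta] divides both elements, hence [p], so [p = p'' * Delta] with [p''] below [z]. As [x] is
   below [p], it is below [z * Delta]. *)
have [p' Ep] : leL Delta p.
  apply: pmax; last by rewrite expgS; exists (Delta ^+ m).
  by have [y ->] := Delta_slide x; exists y.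
have [p'' Ep''] := Delta_slide_back p'.
apply: (@leL_trans p); first by apply: pmax => //; exists Delta.
rewrite -Ep -Ep''; apply/leL_mulr_Delta; apply: zmax; apply/leL_mulr_Delta.
  by rewrite Ep'' Ep.
by rewrite Ep'' Ep -expgSr.
Qed.

(** A nontrivial [s] contributes at least one atom, so splitting it off lowers the length bound.
    This drives the induction in [reachable_conj]. *)
Lemma finite_length_factor s c N : s <> 1 ->
  (forall w : seq M, {in w, forall x, atom x} ->
     \prod_(x <- w) x = s * c -> size w <= N) ->
  (0 < N) /\ (forall w : seq M, {in w, forall x, atom x} ->
     \prod_(x <- w) x = c -> size w <= N.-1).
Proof.
have [gen _] := garside_atomic gM.
move=> s1 hN; have [w ws ws'] := gen s.
have w0 : 0 < size w by case: w ws' {ws} => //; rewrite big_nil => /esym.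
have le v : {in v, forall x, atom x} -> \prod_(x <- v) x = c ->
    size w + size v <= N.
  move=> hv vc; rewrite -size_cat; apply: hN; last by rewrite big_cat /= ws' vc.
  by move=> x; rewrite mem_cat => /orP [/ws | /hv].
split=> [|v hv vc].
  have [v hv vc] := gen c.
  exact: leq_trans w0 (leq_trans (leq_addr _ _) (le v hv vc)).
rewrite -ltnS; apply: (leq_trans _ (leqSpred N)).
by apply: leq_trans (le v hv vc); rewrite -add1n leq_add2r.
Qed.

Lemma simple_below c : c <> 1 -> exists s, [/\ s <> 1, leL s Delta & leL s c].
Proof.
have [w] := simple_prod c; elim: w c => [|a w IH] c ws <-; first by rewrite big_nil.
rewrite big_cons; case: (eqVneq a 1) => [->|/eqP a1].
  by rewrite mul1g; apply: IH => // b bw; apply: ws; rewrite inE bw orbT.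
by exists a; split=> //; [apply/ws/mem_head | exists (\prod_(x <- w) x)].
Qed.

(* Since c <= x c = c y, the meet of c with x^m is trivial for all m as soon as
it is trivial for m = 1. *)
Lemma simple_conjugator x y c m : x * c = c * y -> leL Delta (x ^+ m) ->
  c <> 1 -> exists s, [/\ s <> 1, leL s Delta, leL s c & leL s x].
Proof.
move=> xc Dx c1; have [g [gc gx gmax]] := glb_ex c x.
case: (eqVneq g 1) => [g1|/eqP g1]; last first.
  have [s [s1 sD sg]] := simple_below g1.
  by exists s; split=> //; apply: leL_trans sg _.
have [a [a1 aD ac]] := simple_below c1.
case: a1; move: (leL_trans aD Dx) => {aD Dx}.
elim: m a ac => [|m IH] a ac ax; first by apply: leL_anti (le1x _).
(* Write the join of [a] and [x] as [x * t]. Then [t] is below both [c] and [x ^+ m], so [t = 1] by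
   induction, and [a] is below [x]. *)
have [j [aj xj jmin]] := lub_ex a x.
have [t jt] := xj.
have axc : leL a (x * c) by rewrite xc; apply: leL_trans ac (leL_mulr _ _).
have tc : leL t c.
  by apply: (leL_mul2l x _ _).1; rewrite jt; apply: jmin => //; exists c.
have tx : leL t (x ^+ m).
  apply: (leL_mul2l x _ _).1; rewrite jt -expgS; apply: jmin => //.
  by exists (x ^+ m); rewrite expgS.
have t1 := IH t tc tx; move: jt; rewrite t1 mulg1 => jx.
by apply: leL_anti (le1x _); rewrite -g1; apply: gmax => //; rewrite jx.
Qed.

(** * Central elements and their roots *)

Section Central.
Variable D : M.
Hypothesis Dcentral : forall x, x * D = D * x.

Lemma central_exp x m : x * D ^+ m = D ^+ m * x.
Proof. exact: commuteX (Dcentral x). Qed.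

Lemma central_factor_comm x y m : x * y = D ^+ m -> y * x = D ^+ m.
Proof. by move=> xy; apply: (cancelL (a := x)); rewrite mulgA xy central_exp. Qed.

Lemma conj_exp x z s q : x * s = s * z -> x ^+ q * s = s * z ^+ q.
Proof.
move=> xs; elim: q => [|q IH]; first by rewrite !expg0 mulg1 mul1g.
by rewrite expgS -mulgA IH mulgA xs -mulgA -expgS.
Qed.

Lemma conj_root x z s q : x * s = s * z -> (x ^+ q = D <-> z ^+ q = D).
Proof.
move=> /(@conj_exp _ _ _ q) xs; split=> E; rewrite E ?Dcentral in xs.
  by apply: (cancelL (a := s)); rewrite -xs Dcentral.
by apply: (cancelR (a := s)); rewrite xs.
Qed.

Lemma leL_central_exp x : leL Delta D -> exists m, leL x (D ^+ m).
Proof.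
move=> DeltaD; have [w] := simple_prod x; elim: w x => [|a w IH] x ws <-.
  by exists 0; rewrite big_nil; exact: leL_refl.
have [||m [z hz]] := IH (\prod_(b <- w) b) => //.
  by move=> b bw; apply: ws; rewrite inE bw orbT.
have [y ay] := leL_trans (ws a (mem_head _ _)) DeltaD.
exists m.+1, (z * y); rewrite big_cons -mulgA (mulgA _ z) hz mulgA.
by rewrite central_exp -mulgA ay -expgSr.
Qed.

End Central.
End Garside.
(** * Words and moves *)

Definition reachable t u v :=
  exists2 p, path (fun x y => y \in moves t x) u p & last u p = v.

Lemma reachable_refl t u : reachable t u u.
Proof. by exists [::]. Qed.

Lemma reachable_trans t v u w :
  reachable t u v -> reachable t v w -> reachable t u w.
Proof.
move=> [p pp <-] [q pq <-]; exists (p ++ q); last by rewrite last_cat.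
by rewrite cat_path pp.
Qed.

Lemma reachable_step t u v : v \in moves t u -> reachable t u v.
Proof. by move=> uv; exists [:: v] => //=; rewrite uv. Qed.

Lemma mem_closure t k u v :
  reflect (exists p, [/\ path (fun x y => y \in moves t x) u p,
                         last u p = v & size p <= k])
    (v \in closure t k u).
Proof.
elim: k v => [|k IH] v.
  rewrite inE; apply: (iffP eqP) => [->|[p [_ <-]]]; last by case: p.
  by exists [::].
rewrite /closure iterS mem_cat -/(closure t k u).
apply: (iffP orP) => [[/IH [p [pp pv sp]] | /flatten_mapP [w /IH [p [pp <- sp]] wv]]
                     | [p [pp pv sp]]].
- by exists p; split=> //; apply: leqW.
- by exists (rcons p v); rewrite rcons_path pp wv last_rcons size_rcons.
move: pp pv sp; case: (lastP p) => [|q w] pp pv sp.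
  by left; apply/IH; exists [::].
move: pp pv sp; rewrite rcons_path last_rcons size_rcons => /andP [pq qw] <- sq.
by right; apply/flatten_mapP; exists (last u q) => //; apply/IH; exists q.
Qed.

Lemma head_filter (P : pred nat) s : has P s ->
  head 0 (filter P s) \in s /\ P (head 0 (filter P s)).
Proof.
rewrite has_filter; case E: (filter P s) => [|i q] // _ /=.
have : i \in filter P s by rewrite E mem_head.
by rewrite mem_filter => /andP [].
Qed.

Section Words.
Variables (M : monoidType) (Delta : M) (t : table) (sv : nat -> M).
Hypothesis gM : garside_monoid Delta.
Let n := size t.
Hypothesis sv_simple : forall i, i < n -> leL (sv i) Delta.
Hypothesis sv_onto : forall a, leL a Delta -> exists2 i, i < n & sv i = a.
Hypothesis sv_inj : forall i j, i < n -> j < n -> sv i = sv j -> i = j.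
Hypothesis entryP : forall i j k, i < n -> j < n -> k < n ->
  entry t i j = k.+1 <-> sv i * sv j = sv k.

Implicit Types (u v w : seq nat).

Let cancelL := garside_cancelL gM.

Definition ev w := \prod_(i <- w) sv i.
Definition wf w := all (gtn n) w.

Lemma ev_nil : ev [::] = 1.
Proof. exact: big_nil. Qed.

Lemma ev_cons a w : ev (a :: w) = sv a * ev w.
Proof. exact: big_cons. Qed.

Lemma ev_cat u v : ev (u ++ v) = ev u * ev v.
Proof. exact: big_cat. Qed.

Lemma ev_seq1 a : ev [:: a] = sv a.
Proof. by rewrite ev_cons ev_nil mulg1. Qed.

Lemma wf_cat u v : wf (u ++ v) = wf u && wf v.
Proof. exact: all_cat. Qed.

Lemma ev_nseq m a : ev (nseq m a) = sv a ^+ m.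
Proof. by elim: m => [|m IH]; rewrite ?ev_nil //= ev_cons IH -expgS. Qed.

Lemma ev_power k u : ev (power k u) = ev u ^+ k.
Proof. by elim: k => [|k IH]; rewrite ?ev_nil //= ev_cat IH expgS. Qed.

Lemma wf_power k u : wf u -> wf (power k u).
Proof. by move=> wu; elim: k => //= k; rewrite wf_cat wu. Qed.

Lemma size_power k u : size (power k u) = (k * size u)%N.
Proof. by elim: k => //= k; rewrite size_cat mulSn => ->. Qed.

Lemma mem_letters i : (i \in letters t) = (i < n).
Proof. by rewrite mem_iota. Qed.

Lemma one_letterP : one_letter t < n /\ sv (one_letter t) = 1.
Proof.
have [i ltin si] := sv_onto (le1x Delta).
have [|lt1 e] := @head_filter (fun i => entry t i i == i.+1) (letters t).
  apply/hasP; exists i; first by rewrite mem_letters.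
  by apply/eqP/entryP => //; rewrite si mulg1.
move: lt1 e; rewrite -/(one_letter t) mem_letters => lt1 /eqP /entryP e.
split=> //; apply: (cancelL (a := sv (one_letter t))).
by rewrite mulg1; apply: e.
Qed.

Lemma delta_letterP : delta_letter t < n /\ sv (delta_letter t) = Delta.
Proof.
have [i ltin si] := sv_onto (leL_refl Delta).
have divP d : d < n -> all (fun i => has (fun j => entry t i j == d.+1)
    (letters t)) (letters t) -> leL Delta (sv d).
  move=> ltd /allP /(_ i); rewrite mem_letters => /(_ ltin) /hasP [j].
  rewrite mem_letters => ltj /eqP /entryP <- //; rewrite si; exact: leL_mulr.
have [|lt d] := @head_filter (fun d => all (fun i => has (fun j =>
    entry t i j == d.+1) (letters t)) (letters t)) (letters t).
- apply/hasP; exists i; first by rewrite mem_letters.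
  apply/allP => j; rewrite mem_letters => ltj.
  have [y yD] := sv_simple ltj.
  have [k ltk sk] : exists2 k, k < n & sv k = y.
    apply: sv_onto; apply: (leL_factor_simple gM (r := sv j)).
    by rewrite yD; exact: leL_refl.
  apply/hasP; exists k; first by rewrite mem_letters.
  by apply/eqP/entryP => //; rewrite sk yD si.
move: lt d; rewrite -/(delta_letter t) mem_letters => lt /(divP _ lt) d.
by split=> //; apply: (leL_anti gM) (sv_simple lt) d.
Qed.

Lemma transferableP a b c d : a < n -> b < n -> c < n -> d < n ->
  reflect (exists2 r, leL r Delta &
             sv a * r = sv c /\ r * sv d = sv b \/
             sv c * r = sv a /\ r * sv b = sv d)
    (transferable t a b c d).
Proof.
move=> lta ltb ltc ltd; apply: (iffP hasP) => [[r]|[r0 /sv_onto [r ltr <-] h]].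
  rewrite mem_letters => ltr h; exists (sv r); first exact: sv_simple.
  by case/orP: h => /andP [/eqP /entryP h1 /eqP /entryP h2]; [left | right];
    split; auto.
exists r; first by rewrite mem_letters.
by case: h => -[/entryP h1 /entryP h2]; apply/orP; [left | right];
  apply/andP; split; apply/eqP; auto.
Qed.

Lemma mem_words m w : (w \in words t m) = (size w == m) && wf w.
Proof.
elim: m w => [|m IH] w; first by case: w.
apply/flatten_mapP/idP => [[a]|].
  by rewrite mem_letters => lta /mapP [v]; rewrite IH => /andP [/eqP <- wv] -> /=;
    rewrite eqxx lta.
case: w => // a w /= /andP [/eqP [sw] /andP [lta ww]].
exists a; first by rewrite mem_letters.
by apply: map_f; rewrite IH sw eqxx.
Qed.

Lemma movesP a b w v : wf [:: a, b & w] ->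
  reflect (v = (b :: w) ++ [:: a] \/
           exists c d r, [/\ v = [:: c, d & w], c < n, d < n, leL r Delta &
             sv a * r = sv c /\ r * sv d = sv b \/
             sv c * r = sv a /\ r * sv b = sv d])
    (v \in moves t [:: a, b & w]).
Proof.
move=> /and3P [lta ltb _]; rewrite inE.
apply: (iffP orP) => -[/eqP|]; try by left.
  move=> /flatten_mapP [c]; rewrite mem_letters => ltc /mapP [d].
  rewrite mem_filter mem_letters => /andP [tr ltd] ->.
  have [r rD h] := elimT (transferableP lta ltb ltc ltd) tr.
  by right; exists c, d, r.
move=> [c [d [r [-> ltc ltd rD h]]]]; right.
apply/flatten_mapP; exists c; rewrite ?mem_letters //.
apply: map_f; rewrite mem_filter mem_letters ltd andbT.
by apply/transferableP => //; exists r.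
Qed.

(** A rotation conjugates by the first letter; a transfer keeps the product. *)
Lemma moves_sound u v : 1 < size u -> wf u -> v \in moves t u ->
  [/\ size v = size u, wf v & exists s, ev u * s = s * ev v].
Proof.
case: u => [|a [|b w]] // _ wu /(movesP _ wu).
case=> [->|[c [d [r [-> ltc ltd _ h]]]]].
  rewrite size_cat addn1 wf_cat; split=> //.
    by move: wu => /= /andP [-> ->].
  by exists (sv a); rewrite ev_cat ev_seq1 (ev_cons a) mulgA.
split=> //; first by move: wu => /= /and3P [_ _ ->]; rewrite ltc ltd.
exists 1; rewrite mulg1 mul1g !ev_cons.
by case: h => -[<- <-]; rewrite !mulgA.
Qed.

Lemma reachable_sound u v : 1 < size u -> wf u -> reachable t u v ->
  [/\ size v = size u, wf v & exists s, ev u * s = s * ev v].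
Proof.
move=> su wu [p pp <-]; elim: p u su wu pp => [|v' p IH] u su wu /=.
  by move=> _; split=> //; exists 1; rewrite mulg1 mul1g.
move=> /andP [/moves_sound [] // sv' wv' [s es] pp].
have [|//|//|-> -> [s' es']] := IH v'; first by rewrite sv'.
split=> //; exists (s * s').
by rewrite mulgA es -mulgA es' mulgA.
Qed.

(** Moves preserve the length [m], so a path without repetitions is no longer than the number of
    words of that length. *)
Lemma closureP m u v : 1 < m -> u \in words t m ->
  reflect (reachable t u v) (v \in closure t (size (words t m)) u).
Proof.
rewrite mem_words => lt1m /andP [/eqP su wu].
apply: (iffP (mem_closure _ _ _ _)) => [[p [pp pv _]]|[p0 + <-]].
  by exists p.
move=> /shortenP [p pp up _]; exists p; split=> //.
apply: ltnW; rewrite -[(size p).+1]/(size (u :: p)); apply: uniq_leq_size => // w.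
rewrite mem_words => wp.
have [|//||-> -> _] := @reachable_sound u w; rewrite ?su ?eqxx //.
move: wp; rewrite inE => /orP [/eqP ->|]; first exact: reachable_refl.
move: pp => /[swap] /path.splitP [p1 p2]; rewrite cat_path => /andP [p1p _].
by exists (rcons p1 w); rewrite ?last_rcons.
Qed.

(** * Rotations and greedy normal forms *)

Lemma reachable_rot p q : 1 < size (p ++ q) -> wf (p ++ q) ->
  reachable t (p ++ q) (q ++ p).
Proof.
elim: p q => [|a p IH] q s1 wpq; first by rewrite cats0; exact: reachable_refl.
apply: (@reachable_trans _ ((p ++ q) ++ [:: a])).
  by apply: reachable_step; rewrite inE eqxx.
have := IH (q ++ [:: a]); rewrite -!catA; apply.
  by move: s1; rewrite !size_cat /= addn1 addnS.
by move: wpq; rewrite cat_cons /= !wf_cat /= => /and3P [-> -> ->].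
Qed.

(** Transfers act on the first two letters only. Allowing an arbitrary prefix [p] makes the relation
    stable under prepending letters. *)
Definition linked u v :=
  forall p, wf p -> reachable t (p ++ u) (p ++ v) /\ reachable t (p ++ v) (p ++ u).

Lemma linked_refl u : linked u u.
Proof. by split; exact: reachable_refl. Qed.

Lemma linked_sym u v : linked u v -> linked v u.
Proof. by move=> uv p /uv []. Qed.

Lemma linked_trans v u w : linked u v -> linked v w -> linked u w.
Proof.
move=> uv vw p wp; have [uv1 uv2] := uv p wp; have [vw1 vw2] := vw p wp.
by split; [apply: reachable_trans uv1 vw1 | apply: reachable_trans vw2 uv2].
Qed.

Lemma linked_cons a u v : a < n -> linked u v -> linked (a :: u) (a :: v).
Proof.
by move=> lta uv p wp; rewrite -!cat_rcons; apply: uv; rewrite -cats1 wf_cat wp /= lta.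
Qed.

Lemma linked_transfer a b c d w r : wf [:: a, b & w] -> c < n -> d < n ->
  leL r Delta -> sv a * r = sv c -> r * sv d = sv b ->
  linked [:: a, b & w] [:: c, d & w].
Proof.
move=> wu ltc ltd rD ac db p wp.
have wv : wf [:: c, d & w] by move: wu => /and3P [_ _ ww]; apply/and3P.
have wup : wf [:: a, b & w ++ p] by rewrite -!cat_cons wf_cat wu.
have wvp : wf [:: c, d & w ++ p] by rewrite -!cat_cons wf_cat wv.
have sz x y : 1 < size (p ++ [:: x, y & w]) by rewrite size_cat /= !addnS.
(* Rotate the prefix [p] to the end, make the transfer, and rotate back. *)
have rot x y z y' : wf [:: x, y & w] ->
    reachable t ([:: x, y & w] ++ p) ([:: z, y' & w] ++ p) ->
    wf [:: z, y' & w] -> reachable t (p ++ [:: x, y & w]) (p ++ [:: z, y' & w]).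
  move=> wxy r1 wzy; apply: reachable_trans (reachable_rot _ _) _ => //.
    by rewrite wf_cat wp.
  apply: reachable_trans r1 (reachable_rot _ _); last by rewrite wf_cat wp wzy.
  by rewrite size_cat addnC -size_cat.
by split; apply: rot => //; apply: reachable_step; apply/movesP => //; right;
  [exists c, d, r | exists a, b, r]; split=> //; move: wu => /and3P []; auto.
Qed.

(** Only the first letter is claimed to be greedy; [linked_same_ev] recurses on the tail. *)
Lemma normal_form w : wf w -> w <> [::] -> exists a v,
  [/\ wf (a :: v), size (a :: v) = size w, linked w (a :: v), ev w = ev (a :: v)
    & is_glb (@leL M) (ev w) Delta (sv a)].
Proof.
elim: w => // a [_ | x w IH] /andP [lta ww] _.
  exists a, [::]; split=> //; [exact/andP | exact: linked_refl|].
  by rewrite ev_seq1; split=> //; [exact: leL_refl | exact: sv_simple].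
have [//|//|b [v [/andP [ltb wv] sv1 lv ev1 [bx bD bmax]]]] := IH.
have [r ar] := sv_simple lta.
have rD : leL r Delta.
  by apply: (leL_factor_simple gM (r := sv a)); rewrite ar; exact: leL_refl.
(* The largest factor of [b] that [a] can absorb while staying simple is the meet of [b] with the
   complement [r] of [a]. *)
have [rho [rhob rhor rhomax]] := glb_ex gM (sv b) r.
have [sigma bE] := rhob.
have rhoD : leL rho Delta by apply: (leL_trans gM) rhor rD.
have [c ltc cE] : exists2 c, c < n & sv c = sv a * rho.
  by apply: sv_onto; rewrite -ar; apply/(leL_mul2l gM).
have [d ltd dE] : exists2 d, d < n & sv d = sigma.
  apply: sv_onto; apply: (leL_factor_simple gM (r := rho)).
  by rewrite bE; exact: sv_simple.
have evE : ev [:: a, x & w] = ev [:: c, d & v].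
  by rewrite ev_cons ev1 !ev_cons cE dE -bE !mulgA.
exists c, (d :: v); split=> //.
- by apply/and3P.
- exact: congr1 sv1.
- apply: (@linked_trans [:: a, b & v]); first exact: linked_cons.
  apply: (@linked_transfer _ _ _ _ _ rho) => //; last by rewrite dE.
  by apply/and3P.
split; first by rewrite evE ev_cons; exact: leL_mulr.
  exact: sv_simple.
(* Let the join of [y] and [a] be [a * e]. It divides both [Delta = a * r] and the whole product, so
   [e] is below [r] and [b], hence below [rho]. *)
move=> y yw yD; have [j [yj aj jmin]] := lub_ex gM y (sv a).
have [e je] := aj; apply: (leL_trans gM yj); rewrite cE -je.
apply/(leL_mul2l gM).
have er : leL e r.
  by apply/(leL_mul2l gM (sv a)); rewrite je ar; apply: jmin => //; exact: sv_simple.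
apply: rhomax => //; apply: bmax; last exact: (leL_trans gM) er rD.
apply/(leL_mul2l gM (sv a)); rewrite je -ev_cons; apply: jmin => //.
by rewrite ev_cons; exact: leL_mulr.
Qed.

(** Both words are linked to words starting with the meet of the common value and [Delta]. Cancel
    this letter and compare the tails. *)
Lemma linked_same_ev u v :
  wf u -> wf v -> size u = size v -> ev u = ev v -> linked u v.
Proof.
move: {2}(size u) (erefl (size u)) => m.
elim: m u v => [|m IH] u v su wu wv suv euv.
  by rewrite (size0nil su) (@size0nil _ v) -?suv //; exact: linked_refl.
have [||a [u' [/andP [lta wu'] su' lu eu ga]]] := @normal_form u => //.
  by move=> u0; rewrite u0 in su.
have [||b [v' [/andP [ltb wv'] sv' lv ev' gb]]] := @normal_form v => //.
  by move=> v0; rewrite suv v0 in su.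
have ab : a = b.
  by apply: sv_inj => //; rewrite euv in ga; exact: (glb_uniq gM ga gb).
apply: (linked_trans lu); apply: (linked_trans _ (linked_sym lv)).
rewrite -ab; apply: linked_cons => //; apply: IH => //.
- by move: su'; rewrite su => -[].
- by move: su' sv'; rewrite suv => <- [].
by apply: (cancelL (a := sv a)); rewrite -ev_cons -eu euv ev' ab ev_cons.
Qed.

(** [leL_Delta_exp_factor] peels off one last simple factor per power of [Delta], giving exactly [m]
    letters, some possibly trivial. *)
Lemma word_of_divisor x m : leL x (Delta ^+ m) ->
  exists w, [/\ wf w, size w = m & ev w = x].
Proof.
elim: m x => [|m IH] x xD.
  exists [::]; split=> //; rewrite ev_nil.
  by apply: (leL_anti gM) (le1x _) xD.
have [z [a [-> /IH [w [ww <- <-]] /sv_onto [i lti <-]]]] :=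
  leL_Delta_exp_factor gM xD.
by exists (w ++ [:: i]); rewrite wf_cat ww /= lti size_cat addn1 ev_cat ev_seq1.
Qed.

Lemma ev_pad u m : ev (pad t u m) = ev u.
Proof.
by rewrite ev_cat ev_nseq (one_letterP.2); elim: m => [|m IH];
  rewrite ?expg0 ?mulg1 // expgS mul1g.
Qed.

Lemma wf_pad u m : wf u -> wf (pad t u m).
Proof.
by rewrite wf_cat => ->; rewrite /wf all_nseq /= one_letterP.1 orbT.
Qed.

(** * Conjugacy of roots of a central power of Delta *)

Section CentralPower.
Variable e : nat.
Hypothesis e_gt0 : 0 < e.
Hypothesis De_central : forall x, x * Delta ^+ e = Delta ^+ e * x.
Notation D := (Delta ^+ e).

Lemma leL_Delta_central : leL Delta D.
Proof. by case: (e) e_gt0 => // k _; rewrite expgS; exact: leL_mulr. Qed.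

Lemma root_divisor x q : 0 < q -> x ^+ q = D -> leL x D.
Proof. by case: q => // q _ <-; rewrite expgS; exact: leL_mulr. Qed.

(* Conjugation by a simple element [s] dividing the first word amounts to
splitting off [s] and rotating it to the end. *)
Lemma reachable_conj c u v q : wf u -> wf v -> size u = size v -> e < size u ->
  0 < q -> ev u ^+ q = D -> ev u * c = c * ev v -> reachable t u v.
Proof.
move=> + wv + + q0; have [N] := (garside_atomic gM).2 c.
elim: N c u => [|N IH] c u cN wu suv leu uq uc.
all: case: (eqVneq c 1) => [c1|/eqP c1].
(* If [c = 1], the two words have equal values, so they are linked. *)
1, 3: by have [|] := @linked_same_ev u v wu wv suv _ [::] isT => //;
  move: uc; rewrite c1 mulg1 mul1g.
all: have [|s [s1 sD [c' sc] [x' sx]]] := simple_conjugator gM uc _ c1 (m := q);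
  first by rewrite uq; exact: leL_Delta_central.
all: rewrite -sc in cN; have [N0 c'N] := finite_length_factor gM s1 cN.
  by rewrite ltnn in N0.
(* The conjugate [x' * s] is again a root of D, so its divisor [x'] is a product of [e] simple
   elements. *)
have zq : (x' * s) ^+ q = D.
  apply: (conj_root gM De_central (x := ev u) (s := s) q _).1 uq.
  by rewrite -sx mulgA.
have [w [ww sw xw]] : exists w, [/\ wf w, size w = e & ev w = x'].
  apply: word_of_divisor; apply: (leL_trans gM) (root_divisor q0 zq).
  exact: leL_mulr.
have [i lti si] := sv_onto sD.
(* One place is kept free for the letter of [s]; this is where [e < size u] is used. *)
pose r := pad t w (size u - e.+1).
have wr : wf r by exact: wf_pad.
have sr : size (i :: r) = size u.
  by rewrite /= size_cat size_nseq sw -addSn subnKC.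
have evr : ev r = x' by rewrite ev_pad.
have [||ur _] := @linked_same_ev u (i :: r) wu _ (esym sr) _ [::] isT.
- by rewrite /= lti.
- by rewrite ev_cons evr si sx.
apply: (reachable_trans ur).
have wri : wf (r ++ [:: i]) by rewrite wf_cat wr /= lti.
have sri : size (r ++ [:: i]) = size u by rewrite size_cat addn1.
apply: (@reachable_trans _ (r ++ [:: i])).
  apply: (@reachable_rot [:: i] r).
    by rewrite sr; case: (e) e_gt0 leu => //= k _; exact: leq_trans.
  by rewrite /= lti.
(* After the rotation, [c'] is a conjugator: cancel [s] in [s * x' * s * c' = s * c' * ev v]. *)
apply: (IH c') => //; rewrite ?sri //; rewrite ev_cat ev_seq1 evr si //.
by apply: (cancelL (a := s)); rewrite !mulgA sx -mulgA sc uc.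
Qed.

Lemma pad_words u m : wf u -> pad t u m \in words t (size u + m).
Proof. by move=> wu; rewrite mem_words size_cat size_nseq eqxx wf_pad. Qed.

Lemma connected_sound u v : wf u -> wf v -> 1 < size u + size v ->
  connected t u v -> exists s, ev u * s = s * ev v.
Proof.
move=> wu wv suv /(closureP _ suv (pad_words _ wu)).
move=> /reachable_sound [||_ _ [s]]; last by rewrite !ev_pad; exists s.
  by rewrite size_cat size_nseq.
exact: wf_pad.
Qed.

Lemma connected_complete u v c q : wf u -> wf v -> e < size u + size v ->
  0 < q -> ev u ^+ q = D -> ev u * c = c * ev v -> connected t u v.
Proof.
move=> wu wv leuv q0 uq uc.
apply/closureP; [exact: leq_ltn_trans leuv | exact: pad_words |].
apply: (@reachable_conj c _ _ q); rewrite ?ev_pad //; try exact: wf_pad.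
  by rewrite !size_cat !size_nseq addnC.
by rewrite size_cat size_nseq.
Qed.

(* The powers [x ^+ i] with [i <= q] are distinct divisors of [D], hence values
of distinct words of length [e]. *)
Lemma root_exponent_bound x q :
  x <> 1 -> x ^+ q = D -> q < size (words t e).
Proof.
move=> x1 xq; rewrite -[X in X <= _](size_iota 0 q.+1).
rewrite -(size_map (fun i => x ^+ i)) -(size_map ev (words t e)).
apply: uniq_leq_size.
  have inj i j : i <= j -> x ^+ i = x ^+ j -> i = j.
    move=> leij; rewrite -(subnKC leij) expgnDr -{1}[x ^+ i]mulg1 => /cancelL.
    case: (posnP (j - i)) => [-> //|ij0 /esym /(torsion_free gM ij0) /x1 //].
    by rewrite addn0.
  rewrite map_inj_uniq ?iota_uniq // => i j.
  by case/orP: (leq_total i j) => /inj h; [exact: h | move=> /esym /h].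
move=> y /mapP [i]; rewrite mem_iota ltnS => /= leiq ->.
have [w [ww sw <-]] : exists w, [/\ wf w, size w = e & ev w = x ^+ i].
  apply: word_of_divisor; rewrite -xq -(subnKC leiq) expgnDr; exact: leL_mulr.
by apply: map_f; rewrite mem_words sw eqxx.
Qed.

End CentralPower.
End Words.

(** * Periodic elements of the group of fractions *)

Section IntegerPowers.
Variable G : groupType.
Implicit Types (g h x : G) (k l : int).

Lemma expgz_inv g k : expgz g^-1 k = (expgz g k)^-1.
Proof. by case: k => m /=; rewrite expVgn. Qed.

Lemma expgz_conj g x k : expgz (g ^ x) k = expgz g k ^ x.
Proof. by case: k => m /=; rewrite ?conjVg conjXg. Qed.

(** Inverting the equation or [g] makes both exponents nonnegative. *)
Lemma expgz_periodic (Delta g : G) : periodic Delta g ->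
  exists k l : nat, 0 < k /\ (g ^+ k = Delta ^+ l \/ g^-1 ^+ k = Delta ^+ l).
Proof.
move=> [[[|k]|k] [[l|l] [k0 /= gk]]] //.
- by exists k.+1, l; split=> //; left.
- by exists k.+1, l.+1; split=> //; right; rewrite expVgn gk invgK.
- by exists k.+1, l; split=> //; right; rewrite expVgn.
by exists k.+1, l.+1; split=> //; left; apply: invg_inj.
Qed.

Lemma primitive_inv g : primitive g -> primitive g^-1.
Proof.
move=> [g1 pg]; split=> [/eqP|h k gh]; first by rewrite invg_eq1 => /eqP.
by apply: (pg h^-1); rewrite expgz_inv -gh invgK.
Qed.

Lemma primitive_conj g x : primitive g -> primitive (g ^ x).
Proof.
move=> [g1 pg]; split=> [/eqP|h k gh]; first by rewrite conjg_eq1 => /eqP.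
by apply: (pg (h ^ x^-1)); rewrite expgz_conj -gh conjgK.
Qed.

Lemma primitive_expg g h (k : nat) : primitive g -> g = h ^+ k -> k = 1%N.
Proof. by move=> [_ pg] gh; case: (pg h k gh) => [[]|]. Qed.

End IntegerPowers.

(** * Conjugating periodic elements into the monoid *)

Section Fractions.
Variables (M : monoidType) (Delta : M) (G : groupType) (f : M -> G).
Hypothesis gM : garside_monoid Delta.
Hypothesis fG : group_of_fractions f.
Implicit Types (a b c d t x y z : M) (g h : G).

Let f1 : f 1 = 1. Proof. by have [[]] := fG. Qed.
Let fM x y : f (x * y) = f x * f y. Proof. by have [[]] := fG. Qed.
Let finj : injective f. Proof. by have [] := fG. Qed.

Lemma fX x k : f (x ^+ k) = f x ^+ k.
Proof. by elim: k => [|k IH]; rewrite ?f1 // !expgS fM IH. Qed.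

Lemma conj_of_monoid x y c : x * c = c * y -> f x ^ f c = f y.
Proof. by move=> xc; rewrite conjgE -fM xc fM mulKg. Qed.

Variable D : M.
Hypothesis Dcentral : forall x, x * D = D * x.
Hypothesis DeltaD : leL Delta D.

Definition positive g := exists a, f a = g.

Lemma positive_mul g h : positive g -> positive h -> positive (g * h).
Proof. by move=> [a <-] [b <-]; exists (a * b). Qed.

Lemma D_comm g : commute (f D) g.
Proof.
have [_ _ /(_ g) [a [b ->]]] := fG.
by apply: commuteM; last apply: commuteV; rewrite /commute -!fM Dcentral.
Qed.

Lemma Dexp_comm m g : commute (f D ^+ m) g.
Proof. exact/commute_sym/commuteX/commute_sym/D_comm. Qed.

(** The denominator of [g] divides some power of D, which therefore absorbs it. *)
Lemma positive_shift g : exists m, positive (f D ^+ m * g).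
Proof.
have [_ _ /(_ g) [a [b ->]]] := fG.
have [m [b' bb']] := leL_central_exp gM Dcentral b DeltaD.
exists m, (a * b'); rewrite mulgA (Dexp_comm m (f a)).
rewrite -fX -(central_factor_comm gM Dcentral bb') !fM.
by rewrite mulgA mulgK.
Qed.

Lemma positive_shift_le g m k : m <= k ->
  positive (f D ^+ m * g) -> positive (f D ^+ k * g).
Proof.
move=> /subnK <- [a ag]; rewrite expgnDr -mulgA -ag -fX -fM.
by eexists.
Qed.

(** Multiplying the conjugator by a central power of D makes it positive. *)
Lemma conj_in_monoid x y g : f x ^ g = f y -> exists c, x * c = c * y.
Proof.
move=> xy; have [m [c cg]] := positive_shift g; exists c; apply: finj.
have : f x ^ f c = f y.
  rewrite cg conjgM -xy; congr (_ ^ g); apply/conjg_fixP/commgP.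
  exact: commute_sym (Dexp_comm _ _).
by rewrite conjgE !fM => <-; rewrite mulVKg.
Qed.

(** The order on the group is [g <= h] when [g^-1 * h] is positive. As the family is positive, its
    join is built in the monoid. *)
Lemma lub_family (F : nat -> G) q : (forall i, i < q -> positive (F i)) ->
  exists c, (forall i, i < q -> positive ((F i)^-1 * f c)) /\
    forall x, (forall i, i < q -> positive ((F i)^-1 * f x)) -> leL c x.
Proof.
elim: q => [|q IH] pF; first by exists 1; split=> // x _; exact: le1x.
have [i iq|c [cF cmin]] := IH; first exact/pF/ltnW.
have [a aF] := pF q (ltnSn q).
have [j [[d cj] [e aj] jmin]] := lub_ex gM c a.
exists j; split=> [i|x xF].
  rewrite ltnS leq_eqVlt => /orP [/eqP -> | iq].
    by exists e; rewrite -aF -aj fM mulKg.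
  by rewrite -cj fM mulgA; apply: positive_mul (cF _ iq) _; exists d.
apply: jmin; first by apply: cmin => i iq; exact/xF/ltnW.
have [y yx] := xF q (ltnSn q); exists y; apply: finj.
by rewrite fM yx aF mulVKg.
Qed.

(* Let [c] be the least upper bound of the [g ^+ i] with [i < q], up to a
central factor making these positive.  Since [g ^+ q] is above [1], the element
[g * c] is also an upper bound, so that [c^-1 * g * c] is positive. *)
Lemma positive_conj g q t : 0 < q -> g ^+ q = f t ->
  exists c x, g ^ f c = f x.
Proof.
move=> q0 gq.
have [m mF] : exists m, forall i, i < q.+1 -> positive (f D ^+ m * g ^+ i).
  elim: (q.+1) => [|k [m IH]]; first by exists 0.
  have [m' hm'] := positive_shift (g ^+ k); exists (maxn m m') => i.
  rewrite ltnS leq_eqVlt => /orP [/eqP -> | /IH].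
    exact: positive_shift_le (leq_maxr _ _) hm'.
  exact: positive_shift_le (leq_maxl _ _).
pose F i := f D ^+ m * g ^+ i.
have FS i : F i.+1 = g * F i.
  by rewrite /F expgS !mulgA; congr (_ * _); exact: Dexp_comm.
have [i iq|c [cF cmin]] := @lub_family F q; first exact/mF/ltnW.
have step i : i < q -> positive ((F i.+1)^-1 * (g * f c)).
  by move=> iq; rewrite FS invgM -mulgA mulKg; exact: cF.
have [x xE] : positive (g * f c).
  have [d dE] := step 0 q0; have [a aE] := mF 1%N q0.
  by exists (a * d); rewrite fM dE aE -/(F 1%N) mulVKg.
have [y cy] : leL c x.
  apply: cmin => -[_|i iq]; rewrite xE; last exact/step/ltnW.
  (* For [i = 0], [g ^+ q = f t] puts [F q] above [F 0], and [g * f c] is above [F q]. *)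
  have -> : (F 0)^-1 = f t * (F q)^-1.
    by rewrite /F expg0 mulg1 gq invgM mulVKg.
  rewrite -mulgA; apply: positive_mul; first by exists t.
  by case: (q) q0 step => // k _; apply.
by exists c, y; rewrite conjgE -xE -cy fM mulKg.
Qed.

(** A torsion element is conjugate into the monoid, which is torsion-free. *)
Lemma group_torsion_free g q : 0 < q -> g ^+ q = 1 -> g = 1.
Proof.
move=> q0 gq; have [|c [x gx]] := @positive_conj g q 1 q0; first by rewrite f1.
have x1 : x = 1.
  by apply: (torsion_free gM q0); apply: finj; rewrite fX -gx -conjXg gq conj1g.
by apply/eqP; rewrite -(conjg_eq1 g (f c)) gx x1 f1.
Qed.

Lemma root_positive_conj g q : 0 < q -> g ^+ q = f D ->
  exists c x, g ^ f c = f x /\ x ^+ q = D.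
Proof.
move=> q0 gq; have [c [x gx]] := positive_conj q0 gq; exists c, x; split=> //.
apply: finj; rewrite fX -gx -conjXg gq; apply/conjg_fixP/commgP; exact: D_comm.
Qed.

(* A primitive element commensurable with [D] generates together with [D] an
infinite cyclic group, and so is a generator of it. *)
Lemma primitive_root g k l : primitive g -> 0 < k -> g ^+ k = f D ^+ l ->
  exists2 q, 0 < q & g ^+ q = f D.
Proof.
move=> pg k0 gk.
have l0 : 0 < l.
  case: l gk => // gk; case: pg => g1 _; case: g1.
  exact: group_torsion_free k0 gk.
have d0 : 0 < gcdn k l by rewrite gcdn_gt0 k0.
have /dvdnP [k1 kE] := dvdn_gcdl k l; have /dvdnP [l1 lE] := dvdn_gcdr k l.
have k10 : 0 < k1 by move: k0; rewrite kE muln_gt0 => /andP [].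
have comm i j : commute (f D ^+ i) (g ^+ j) by apply: commuteX2; exact: D_comm.
(* The common divisor of the exponents is removed by torsion-freeness, as [g] and D commute. *)
have gk1 : g ^+ k1 = f D ^+ l1.
  apply: divg1_eq; apply: (group_torsion_free d0).
  rewrite expgnFl; last exact: commute_sym.
  by rewrite -!expgnA -kE -lE gk mulgV.
have kl1 : gcdn k1 l1 = 1%N.
  apply/eqP; rewrite -(eqn_pmul2r d0) mul1n muln_gcdl -kE -lE eqxx //.
(* The identity [u * k1 = v * l1 + 1] exhibits [g] as an [l1]-th power, so [l1 = 1] by
   primitivity. *)
case: (egcdnP l1 k10) => u v; rewrite kl1 => uv _.
have gh : g = (f D ^+ u / g ^+ v) ^+ l1.
  rewrite expgnFl // -!expgnA [(u * l1)%N]mulnC expgnA -gk1 -expgnA.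
  by rewrite [(k1 * u)%N]mulnC uv addn1 expgS mulgK.
by exists k1 => //; rewrite gk1 (primitive_expg pg gh) expg1.
Qed.

End Fractions.

(** * Correctness of the algorithm *)

Lemma central_exponentE t : central_exponent t = (size t)`!.
Proof. by rewrite fact_prod unlock /index_iota subn1. Qed.

Section Correctness.
Variables (M : monoidType) (Delta : M) (t : table) (sv : nat -> M).
Variables (G : groupType) (f : M -> G).
Hypothesis gM : garside_monoid Delta.
Hypothesis fG : group_of_fractions f.
Let n := size t.
Hypothesis sv_simple : forall i, i < n -> leL (sv i) Delta.
Hypothesis sv_onto : forall a, leL a Delta -> exists2 i, i < n & sv i = a.
Hypothesis sv_inj : forall i j, i < n -> j < n -> sv i = sv j -> i = j.
Hypothesis entryP : forall i j k, i < n -> j < n -> k < n ->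
  entry t i j = k.+1 <-> sv i * sv j = sv k.
Implicit Types (u v w : seq nat) (x y z : M) (g h : G).

Let e := central_exponent t.
Let D := Delta ^+ e.

(* [Delta] permutes the simple elements by conjugation, and the order of this
permutation divides n!. *)
Lemma central_exponentP x : x * D = D * x.
Proof.
have /fin_all_exists [s hs] : forall i : 'I_n, exists j : 'I_n,
    sv i * Delta = Delta * sv j.
  move=> i; have [y yD ->] := Delta_slide_simple gM (sv_simple (ltn_ord i)).
  by have [j ltj <-] := sv_onto yD; exists (Ordinal ltj).
have s_inj : injective s.
  move=> i j sij; apply/val_inj/sv_inj; rewrite ?ltn_ord //.
  by apply: (garside_cancelR gM (a := Delta)); rewrite !hs sij.
have hsk k (i : 'I_n) : sv i * Delta ^+ k = Delta ^+ k * sv (iter k s i).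
  elim: k => [|k IH]; first by rewrite expg0 mulg1 mul1g.
  by rewrite expgSr mulgA IH -mulgA hs mulgA.
have sve i : i < n -> sv i * D = D * sv i.
  move=> lti; rewrite (hsk e (Ordinal lti)); congr (_ * sv _).
  pose p := perm s_inj.
  have -> : iter e s (Ordinal lti) = (p ^+ e) (Ordinal lti).
    by rewrite permX; apply: eq_iter => j; rewrite permE.
  by rewrite /e central_exponentE -card_Sn -cardsT expg_cardG ?perm1 // inE.
have [w ws <-] := simple_prod gM x.
elim: w ws => [|a w IH] ws; first by rewrite big_nil mul1g mulg1.
rewrite big_cons -mulgA IH; last by move=> b bw; apply: ws; rewrite inE bw orbT.
have [i lti <-] := sv_onto (ws a (mem_head _ _)).
by rewrite mulgA sve // mulgA.
Qed.

Lemma central_exponent_gt0 : 0 < e.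
Proof. by rewrite /e central_exponentE fact_gt0. Qed.

Lemma leL_Delta_D : leL Delta D.
Proof. exact: leL_Delta_central central_exponent_gt0. Qed.

Lemma mem_central_words w : (w \in central_words t) = (size w == e) && wf t w.
Proof. exact: mem_words. Qed.

Lemma word_of_root x q : 0 < q -> x ^+ q = D ->
  exists2 w, w \in central_words t & ev sv w = x.
Proof.
move=> q0 xq; have [w [ww sw xE]] := word_of_divisor gM sv_onto (root_divisor q0 xq).
by exists w => //; rewrite mem_central_words sw eqxx.
Qed.

Lemma connected_conj u v : wf t u -> wf t v -> 0 < size u -> 0 < size v ->
  connected t u v -> exists s, ev sv u * s = s * ev sv v.
Proof.
move=> wu wv u0 v0; apply: (connected_sound gM sv_simple sv_onto entryP) => //.
by case: (size u) (size v) u0 v0 => // k [|l] // _ _; rewrite addSn addnS.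
Qed.

Lemma conj_connected c u v q : wf t u -> wf t v -> 0 < size u -> size v = e ->
  0 < q -> ev sv v ^+ q = D -> ev sv u * c = c * ev sv v -> connected t u v.
Proof.
move=> wu wv u0 sv_e q0 vq uc.
apply: (connected_complete gM sv_simple sv_onto sv_inj entryP
  central_exponent_gt0 central_exponentP (c := c) (q := q)) => //.
  by rewrite sv_e -[X in X < _]add0n ltn_add2r.
exact/(conj_root gM central_exponentP q uc).
Qed.

Lemma is_rootP w : w \in central_words t ->
  reflect (exists2 q, 0 < q & ev sv w ^+ q = D) (is_root t w).
Proof.
move=> win; have [/eqP sw ww] := andP (etrans (esym (mem_central_words w)) win).
have e0 := central_exponent_gt0.
have [ltd dD] := delta_letterP gM sv_simple sv_onto entryP.
have wd : wf t (nseq e (delta_letter t)) by rewrite /wf all_nseq /= ltd orbT.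
have evd : ev sv (nseq e (delta_letter t)) = D by rewrite ev_nseq dD.
have sizes q : 0 < q -> 0 < size (power q w).
  by move=> q0; rewrite size_power muln_gt0 q0 sw.
apply: (iffP hasP) => [[q]|[q q0 wq]].
  rewrite mem_iota => /andP [q0 _] /connected_conj [].
  - exact: wf_power.
  - exact: wd.
  - exact: sizes.
  - by rewrite size_nseq.
  move=> s; rewrite -/e evd ev_power central_exponentP => h.
  by exists q => //; apply: (garside_cancelR gM h).
(* The exponent must lie in the search range. If the value is 1, then D = 1 and [q = 1] will do. *)
have {q q0 wq} [q [q0 ltq wq]] : exists q,
    [/\ 0 < q, q <= size (central_words t) & ev sv w ^+ q = D].
  case: (eqVneq (ev sv w) 1) => [w1|/eqP w1].
    exists 1%N; split=> //; first by case: (central_words t) win.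
    by move: wq; rewrite w1 !expg1n.
  exists q; split=> //; apply: ltnW.
  exact: (root_exponent_bound gM sv_onto w1 wq).
exists q; first by rewrite mem_iota q0 add1n ltnS.
apply: (conj_connected (c := 1) (q := 1)) => //; rewrite ?size_nseq ?evd ?expg1 //.
- exact: wf_power.
- exact: sizes.
by rewrite mulg1 mul1g ev_power.
Qed.

(** Since [y ^+ (k * q) = D], a word of length e represents [y], and [k] is at most the bounded
    exponent [k * q]. *)
Lemma is_power_complete w q y k c : w \in central_words t -> 0 < q ->
  ev sv w ^+ q = D -> 1 < k -> y ^+ k * c = c * ev sv w -> is_power t w.
Proof.
move=> win q0 wq k1 ykc.
have [/eqP sw ww] := andP (etrans (esym (mem_central_words w)) win).
have k0 := ltnW k1.
have ykq : y ^+ (k * q) = D.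
  by rewrite expgnA; apply/(conj_root gM central_exponentP q ykc).
have kq0 : 0 < k * q by rewrite muln_gt0 k0.
(* The exponent bound excludes [y = 1]; in that case the value of [w] is 1, and [w] is its own
   square. *)
case: (eqVneq y 1) => [y1|/eqP y1].
  have D1 : D = 1 by rewrite -ykq y1 expg1n.
  have w1 : ev sv w = 1 by apply: (torsion_free gM q0); rewrite wq.
  apply/hasP; exists w => //; apply/hasP; exists 2.
    by rewrite mem_iota /= add2n !ltnS; case: (central_words t) win.
  apply: (conj_connected (c := 1) _ _ _ _ q0 wq) => //.
  - exact: wf_power.
  - by rewrite size_power muln_gt0 sw central_exponent_gt0.
  by rewrite ev_power w1 expg1n.
have [v vin vy] := word_of_root kq0 ykq.
have [/eqP sv_e wv] := andP (etrans (esym (mem_central_words v)) vin).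
have kq := root_exponent_bound gM sv_onto y1 ykq.
apply/hasP; exists v => //; apply/hasP; exists k.
  rewrite mem_iota k1 add2n ltnS ltnW // ltnS; apply: leq_trans (ltnW kq).
  by rewrite -[X in X <= _]muln1 leq_mul2l q0 orbT.
apply: (conj_connected (c := c) _ _ _ _ q0 wq) => //.
- exact: wf_power.
- by rewrite size_power muln_gt0 k0 sv_e central_exponent_gt0.
by rewrite ev_power vy.
Qed.

Lemma is_power_sound w : w \in central_words t -> is_power t w ->
  exists y k s, 1 < k /\ y ^+ k * s = s * ev sv w.
Proof.
move=> win /hasP [v vin /hasP [k]]; rewrite mem_iota => /andP [k1 _] vw.
have [/eqP sw ww] := andP (etrans (esym (mem_central_words w)) win).
have [/eqP sv_e wv] := andP (etrans (esym (mem_central_words v)) vin).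
have e0 := central_exponent_gt0.
have [||||s] := connected_conj _ _ _ _ vw.
- exact: wf_power.
- exact: ww.
- by rewrite size_power muln_gt0 sv_e ltnW.
- by rewrite sw.
by rewrite ev_power; exists (ev sv v), k, s.
Qed.

(** A root taken in the group is also a root of D, hence conjugate into the monoid, where the search
    finds it. *)
Lemma primitiveP w q : w \in central_words t -> 0 < q -> ev sv w ^+ q = D ->
  reflect (primitive (f (ev sv w))) (~~ is_power t w).
Proof.
move=> win q0 wq; apply: (iffP idP) => [nw|pw]; last first.
  apply/negP => /(is_power_sound win) [y [k [s [k1 /(conj_of_monoid fG)]]]].
  rewrite (fX fG) conjXg => /esym /(primitive_expg pw) k1'.
  by rewrite k1' in k1.
have w1 : ev sv w <> 1.
  move=> w1; case/negP: nw.
  apply: (is_power_complete (y := 1) (k := 2) (c := 1)) wq _ _ => //.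
  by rewrite w1 expg1n.
have [f1 _] := let: And3 h _ _ := fG in h.
have finj : injective f by have [] := fG.
have fw1 : f (ev sv w) <> 1 by rewrite -f1 => /finj.
have npow h k : f (ev sv w) = h ^+ k.+2 -> False.
  move=> wh; case/negP: nw.
  have hD : h ^+ (k.+2 * q) = f D by rewrite expgnA -wh -(fX fG) wq.
  have [|c [y [hy yD]]] :=
    root_positive_conj gM fG central_exponentP leL_Delta_D _ hD.
    by rewrite muln_gt0.
  have [c' hc'] : exists c', y ^+ k.+2 * c' = c' * ev sv w.
    apply: (conj_in_monoid gM fG central_exponentP leL_Delta_D
      (g := (f c)^-1)).
    by rewrite (fX fG) -hy -conjXg conjgK wh.
  exact: (is_power_complete (y := y) (k := k.+2) (c := c')) wq _ _.
(* The exponents are 0, 1, at least 2, -1, and at most -2. *)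
split=> // h [[|[|k]]|[|k]] /= wh.
- by case: fw1; rewrite wh.
- by left.
- by case: (npow _ _ wh).
- by right.
by case: (npow h^-1 k); rewrite expVgn.
Qed.

Let value w := f (ev sv w).
Let reps := representatives t.

Lemma repsP w : w \in reps -> exists q,
  [/\ w \in central_words t, 0 < q, ev sv w ^+ q = D & primitive (value w)].
Proof.
move=> wr; move: (dedupe_sub wr).
rewrite mem_filter => /andP [/andP [rw nw] win].
have [q q0 wq] := elimT (is_rootP win) rw.
by exists q; split=> //; exact: (elimT (primitiveP win q0 wq) nw).
Qed.

Lemma reps_wf w : w \in reps -> wf t w.
Proof.
by move=> /repsP [q [+ _ _ _]]; rewrite mem_central_words => /andP [].
Qed.

Lemma conj_connected_root u v q g : u \in central_words t ->
  v \in central_words t -> 0 < q -> ev sv v ^+ q = D ->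
  value u ^ g = value v -> connected t u v.
Proof.
rewrite !mem_central_words => /andP [/eqP su wu] /andP [/eqP sv_e wv] q0 vq uv.
have [c uc] := conj_in_monoid gM fG central_exponentP leL_Delta_D uv.
by apply: (conj_connected wu wv _ sv_e q0 vq uc); rewrite su central_exponent_gt0.
Qed.

Lemma reps_conj_eq u v g : u \in reps -> v \in reps ->
  value u ^ g = value v -> u = v.
Proof.
move=> ur vr uv; have [q [uin q0 uq _]] := repsP ur.
have [q' [vin q'0 vq _]] := repsP vr.
apply: (dedupe_unrelated ur vr); first exact: conj_connected_root q'0 vq uv.
by apply: (conj_connected_root vin uin q0 uq (g := g^-1)); rewrite -uv conjgK.
Qed.

(** Comparing the powers with exponent [q * q'] would give D to the [q'] equal to D to the [-q],
    making [value u] a torsion element. *)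
Lemma reps_conj_inv u v g : u \in reps -> v \in reps ->
  value u ^ g <> (value v)^-1.
Proof.
move=> ur vr uv; have [q [_ q0 uq [u1 _]]] := repsP ur.
have [q' [_ q'0 vq _]] := repsP vr.
case: u1; apply: (group_torsion_free gM fG central_exponentP leL_Delta_D
  (q := q * (q' + q))); first by rewrite muln_gt0 q0 addn_gt0 q0 orbT.
have fD x k : x ^+ k = D -> f x ^+ k = f D by rewrite -(fX fG) => ->.
have aq : (value u ^ g) ^+ (q * q') = f D ^+ q'.
  rewrite -conjXg expgnA (fD _ _ uq); apply/conjg_fixP/commgP.
  exact: (Dexp_comm fG central_exponentP).
have bq : (value v)^-1 ^+ (q * q') = f D ^- q.
  by rewrite expVgn mulnC expgnA (fD _ _ vq).
by rewrite expgnA (fD _ _ uq) expgnDr -aq uv bq mulVg.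
Qed.

Lemma reps_uniq : uniq [seq value w | w <- reps].
Proof.
rewrite map_inj_in_uniq => [|u v ur vr uv].
  apply: dedupe_uniq => w.
  rewrite mem_filter => /andP [/andP [/[swap] _ rw] win].
  have [q q0 wq] := elimT (is_rootP win) rw.
  by apply: (conj_connected_root win win q0 wq (g := 1)); rewrite conjg1.
by apply: (reps_conj_eq ur vr (g := 1)); rewrite conjg1.
Qed.

Lemma reps_periodic w : w \in reps -> periodic (f Delta) (value w).
Proof.
move=> /repsP [q [_ q0 wq _]]; exists (Posz q), (Posz e); split.
  by case: q q0 {wq}.
by rewrite /= -!(fX fG) wq.
Qed.

Lemma root_conj_rep g k l : primitive g -> 0 < k -> g ^+ k = f Delta ^+ l ->
  exists2 w, w \in reps & conjugate g (value w).
Proof.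
move=> pg k0 gk.
(* Raising to the power [e] turns the power of [Delta] into a power of D. *)
have [||q q0 gq] := primitive_root gM fG central_exponentP leL_Delta_D
  (k := k * e) (l := l) pg.
- by rewrite muln_gt0 k0 central_exponent_gt0.
- by rewrite expgnA gk -!(fX fG) -!expgnA mulnC.
have [c [x [gx xq]]] :=
  root_positive_conj gM fG central_exponentP leL_Delta_D q0 gq.
have [w win wx] := word_of_root q0 xq.
have pw : primitive (f (ev sv w)) by rewrite wx -gx; exact: primitive_conj.
have wq : ev sv w ^+ q = D by rewrite wx.
have [|v vr wv] := @dedupe_complete _ (connected t)
    [seq u <- central_words t | is_root t u && ~~ is_power t u] w.
  rewrite mem_filter win andbT; apply/andP; split.
    by apply/(is_rootP win); exists q.
  exact/(primitiveP win q0 wq).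
exists v => //; case: wv => [<-|wv]; first by exists (f c); rewrite /value wx.
have [q' [vin _ _ _]] := repsP vr.
move: (win) (vin); rewrite !mem_central_words.
move=> /andP [/eqP sw ww] /andP [/eqP sv_e wv'].
have [||s /(conj_of_monoid fG) ws] := connected_conj ww wv' _ _ wv.
- by rewrite sw central_exponent_gt0.
- by rewrite sv_e central_exponent_gt0.
by exists (f c * f s); rewrite conjgM gx -wx.
Qed.

Lemma reps_exists_unique g : primitive g -> periodic (f Delta) g ->
  exists! h, h \in [seq value w | w <- reps] /\
    (conjugate g h \/ conjugate g h^-1).
Proof.
move=> pg /expgz_periodic [k [l [k0 gk]]].
have [w wr gw] : exists2 w, w \in reps &
    conjugate g (value w) \/ conjugate g (value w)^-1.
  case: gk => [gk|gk].
    by have [w wr gw] := root_conj_rep pg k0 gk; exists w => //; left.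
  have [w wr [x gw]] := root_conj_rep (primitive_inv pg) k0 gk.
  by exists w => //; right; exists x; rewrite -gw -conjVg invgK.
exists (value w); split=> [|h [/mapP [v vr ->] {h} gv]].
  by split=> //; exact: map_f.
congr value.
(* Equal signs give conjugate representatives; mixed signs are excluded by [reps_conj_inv]. *)
case: gw gv => -[a ga] [] [b gb].
- by apply: (reps_conj_eq wr vr (g := a^-1 * b)); rewrite conjgM -ga conjgK.
- by case: (@reps_conj_inv w v (a^-1 * b)) => //; rewrite conjgM -ga conjgK.
- case: (@reps_conj_inv v w (b^-1 * a)) => //.
  by rewrite conjgM -gb conjgK.
apply: (reps_conj_eq wr vr (g := a^-1 * b)); apply: invg_inj.
by rewrite -conjVg conjgM -ga conjgK.
Qed.

End Correctness.

(** * From the given structure to the table, and back to words *)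

Definition table_of n (mul : 'I_n -> 'I_n -> option 'I_n) : table :=
  [seq [seq if mul i j is Some k then k.+1 else 0 | j <- enum 'I_n]
    | i <- enum 'I_n].

Lemma encode_seq_map A B (eB : B -> tree) (g : A -> B) s :
  encode_seq eB (map g s) = encode_seq (fun a => eB (g a)) s.
Proof. by elim: s => //= a s ->. Qed.

Lemma eq_encode_seq A (eA eA' : A -> tree) :
  eA =1 eA' -> encode_seq eA =1 encode_seq eA'.
Proof. by move=> h; elim=> //= a s ->; rewrite h. Qed.

(** [None] and 0 have the same code, as do [Some k] and [k.+1]. The program thus reads its input
    directly as a table of numbers. *)
Lemma encode_table n (mul : 'I_n -> 'I_n -> option 'I_n) :
  encode (table_of mul : seq (seq nat)) = encode_structure mul.
Proof.
rewrite /= /encode_structure !encode_seq_map; apply: eq_encode_seq => i.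
by rewrite !encode_seq_map; apply: eq_encode_seq => j; case: (mul i j).
Qed.

Lemma entry_table n (mul : 'I_n -> 'I_n -> option 'I_n) (i j : 'I_n) :
  entry (table_of mul) i j = if mul i j is Some k then k.+1 else 0.
Proof.
rewrite /entry (nth_map i) ?size_enum_ord // (nth_map i) ?size_enum_ord //.
by rewrite !nth_ord_enum.
Qed.

Lemma computable_positive_words :
  computable (fun t : seq (seq nat) =>
    [seq [seq (i, false) | i <- u] | u <- representatives t]).
Proof. have h := computable_representatives; by do !computable_mem_step. Qed.

(** [pmap insub] drops letters that are not below [n]; the representatives contain none. *)
Definition ord_word n (u : seq nat) : word n :=
  [seq (i, false) | i <- pmap insub u].

Lemma encode_ord_words n us : all (all (gtn n)) us ->
  encode_words (map (@ord_word n) us) =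
  encode [seq [seq (i, false) | i <- u] | u <- us].
Proof.
rewrite /encode_words /= !encode_seq_map.
elim: us => //= u us IH /andP [un /IH ->]; congr Node.
rewrite !encode_seq_map; elim: u un => //= i u IHu /andP [lti /IHu E].
by rewrite insubT /= E.
Qed.

Theorem proposition5p2 :
  exists p : prog,
  forall (n : nat) (mul : 'I_n -> 'I_n -> option 'I_n)
         (M : monoidType) (Delta : M) (G : groupType) (iota : M -> G)
         (s : 'I_n -> M),
    garside_monoid Delta ->
    group_of_fractions iota ->
    garside_structure Delta s mul ->
    exists2 ws : seq (word n),
      runs p (encode_structure mul) (encode_words ws)
    & let L := [seq eval_word iota s w | w <- ws] in
      [/\ uniq L,
          forall h : G, h \in L -> primitive h /\ periodic (iota Delta) h
        & forall g : G, primitive g -> periodic (iota Delta) g ->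
            exists! h : G, h \in L /\ (conjugate g h \/ conjugate g h^-1)].
Proof.
have [p hp] := computable_positive_words.
exists p => n mul M Delta G f s gM fG [s_inj s_simple s_mul].
pose t := table_of mul.
(* The value 1 outside the range is a filler: well-formed words use only letters below [n]. *)
pose sv i := oapp s 1 (insub i : option 'I_n).
have tn : size t = n by rewrite size_map size_enum_ord.
have svE (i : 'I_n) : sv i = s i by rewrite /sv valK.
have sv_simple i : i < size t -> leL (sv i) Delta.
  rewrite tn => lti; rewrite (svE (Ordinal lti)).
  by apply/simpleE/s_simple; exists (Ordinal lti).
have sv_onto a : leL a Delta -> exists2 i, i < size t & sv i = a.
  by move=> /simpleE /s_simple [i <-]; exists i; rewrite ?tn.
have sv_inj i j : i < size t -> j < size t -> sv i = sv j -> i = j.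
  rewrite tn => lti ltj; rewrite (svE (Ordinal lti)) (svE (Ordinal ltj)).
  by move=> /s_inj [].
have entryP i j k : i < size t -> j < size t -> k < size t ->
    entry t i j = k.+1 <-> sv i * sv j = sv k.
  rewrite tn => lti ltj ltk.
  rewrite (svE (Ordinal lti)) (svE (Ordinal ltj)) (svE (Ordinal ltk)).
  apply: (iff_trans _ (s_mul _ _ _)).
  rewrite (entry_table _ (Ordinal lti) (Ordinal ltj)).
  case: (mul _ _) => [[m ltm]|] //; split=> // -[e]; last by rewrite /= e.
  by congr Some; apply: val_inj.
have wfr u : u \in representatives t -> all (gtn n) u.
  move=> ur; rewrite -tn.
  exact: (reps_wf gM fG sv_simple sv_onto sv_inj entryP ur).
exists [seq ord_word n u | u <- representatives t].
  rewrite encode_ord_words; last by apply/allP.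
  by rewrite -encode_table; exact: hp.
have -> : [seq eval_word f s w | w <- [seq ord_word n u | u <- representatives t]]
    = [seq f (ev sv u) | u <- representatives t].
  rewrite -map_comp; apply/eq_in_map => u /wfr /=.
  have [[f1 fM] _ _] := fG.
  rewrite /eval_word; elim: u => [|i u IH]; first by rewrite ev_nil big_nil f1.
  move=> /= /andP [lti /IH E]; rewrite /ord_word /= insubT /=.
  by rewrite big_cons E ev_cons fM (svE (Ordinal lti)).
split.
- exact: (reps_uniq gM fG sv_simple sv_onto sv_inj entryP).
- move=> h /mapP [u ur ->].
  have [q [_ _ _ pu]] := repsP gM fG sv_simple sv_onto sv_inj entryP ur.
  by split=> //; exact: (reps_periodic gM fG sv_simple sv_onto sv_inj entryP ur).
exact: (reps_exists_unique gM fG sv_simple sv_onto sv_inj entryP).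
Qed.
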